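(* For every $n\ge 1$ and every $0\le k\le n-1$, the set $\mathcal B_{n,k}$ is a basis of the $\Bbbk$-vector space $\mathcal R_{n,k}$. Consequently, $\bigcup_{k=0}^{n-1}\mathcal B_{n,k}$ is a basis of $\mathcal R(n)$.
   Context: Let $\Bbbk$ be a field of characteristic zero, $[n]=\{1,\dots,n\}$, and let $p_1,\dots,p_n$ be independent variables. For $I\subseteq[n]$ nonempty put $p_I=\sum_{i\in I}p_i$. A multilinear $\prec,\succ$-monomial in $x_1,\dots,x_n$ is a nonassociative monomial in two binary operations $\prec$ and $\succ$ in which every $x_i$ occurs exactly once. To such a monomial $T$ one associates its coefficient $c_T\in\Bbbk(p_1,\dots,p_n)$ recursively by $c_{x_i}=1$, $c_{U\prec V}=p_V\,c_Uc_V$, $c_{U\succ V}=c_Uc_V/p_U$, where $p_U$ is the sum of the $p_i$ over the variables $x_i$ occurring in $U$. $\mathcal R(n)$ is the $\Bbbk$-span of all $c_T$, and $\mathcal R_{n,k}$ is the $\Bbbk$-span of the $c_T$ with $T$ containing exactly $k$ occurrences of $\prec$ (hence $n-1-k$ occurrences of $\succ$). The set $\mathcal B_{n,k}$ consists of all rational functions $$\frac{M_1M_2\cdots M_{j+1}}{p_{I_1}p_{I_2}\cdots p_{I_j}}$$ arising from the following data: an integer $j\ge0$; a strict chain $\varnothing=I_0\subsetneq I_1\subsetneq\cdots\subsetneq I_j\subsetneq I_{j+1}=[n]$, with $B_s=I_s\setminus I_{s-1}$ for $1\le s\le j+1$; integers $d_1,\dots,d_{j+1}$ with $0\le d_s\le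 |B_s|-1$, $d_s\equiv|B_s|-1\pmod 2$, and $d_1+\cdots+d_{j+1}=2k+j-n+1$; for each $1\le s\le j$ a monomial $M_s$ (with coefficient $1$) of total degree $d_s$ in the variables $\{p_a\mid a\in B_s\setminus\{\max B_s\}\}$; and a monomial $M_{j+1}$ (with coefficient $1$) of total degree $d_{j+1}$ in the variables $\{p_a\mid a\in B_{j+1}\}$. (The only monomial of degree $0$ is $1$.) *)

(* Defs.v *)
From HB Require Import structures.
From mathcomp Require Import all_boot all_order all_algebra.
From mathcomp Require Export mpoly.

Set Implicit Arguments.
Unset Strict Implicit.
Unset Printing Implicit Defensive.

Import GRing.Theory.

Local Open Scope ring_scope.

(* Spans and bases in a vector space that need not be finite-dimensional, with
   subsets as Prop-valued predicates. *)
Section LinearAlgebra.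
Variables (K : fieldType) (V : lmodType K).
Implicit Types S U : V -> Prop.

Definition in_span S (v : V) : Prop :=
  exists (m : nat) (c : 'I_m -> K) (x : 'I_m -> V),
    (forall i, S (x i)) /\ v = \sum_(i < m) c i *: x i.

Definition lin_indep S : Prop :=
  forall (m : nat) (c : 'I_m -> K) (x : 'I_m -> V),
    injective x -> (forall i, S (x i)) ->
    \sum_(i < m) c i *: x i = 0 -> forall i, c i = 0.

Definition is_basis S U : Prop :=
  lin_indep S /\ (forall v, U v <-> in_span S v).

End LinearAlgebra.

(* K(p_1, ..., p_n), with the variables indexed by 'I_n = {0, ..., n-1}. *)
Notation ratfun K n := {fraction {mpoly K[n]}}.

Local Notation "q %:F" := (tofrac q).

Section RatfunLmodule.
Variables (K : fieldType) (n : nat).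

Definition ratfun_scale (c : K) (f : ratfun K n) : ratfun K n := c%:MP%:F * f.

Fact ratfun_scaleA a b f :
  ratfun_scale a (ratfun_scale b f) = ratfun_scale (a * b) f.
Proof. by rewrite /ratfun_scale mulrA mpolyCM tofracM. Qed.

Fact ratfun_scale1 : left_id 1 ratfun_scale.
Proof. by move=> f; rewrite /ratfun_scale tofrac1 mul1r. Qed.

Fact ratfun_scaleDr : right_distributive ratfun_scale +%R.
Proof. by move=> c f g; rewrite /ratfun_scale mulrDr. Qed.

Fact ratfun_scaleDl f : {morph ratfun_scale^~ f : a b / a + b}.
Proof. by move=> a b; rewrite /ratfun_scale mpolyCD tofracD mulrDl. Qed.

HB.instance Definition _ := GRing.Zmodule_isLmodule.Build K (ratfun K n)
  ratfun_scaleA ratfun_scale1 ratfun_scaleDr ratfun_scaleDl.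

Definition psum (I : {set 'I_n}) : ratfun K n := (\sum_(i in I) 'X_i)%:F.

End RatfunLmodule.

Section Trees.
Variable n : nat.

Inductive tree : Type :=
  | Leaf of 'I_n
  | Prec of tree & tree
  | Succ of tree & tree.

Fixpoint leaves (T : tree) : seq 'I_n :=
  match T with
  | Leaf i => [:: i]
  | Prec U V | Succ U V => leaves U ++ leaves V
  end.

Definition vars (T : tree) : {set 'I_n} := [set i in leaves T].

Definition multilinear (T : tree) : Prop :=
  forall i : 'I_n, count_mem i (leaves T) = 1%N.

Fixpoint nprec (T : tree) : nat :=
  match T with
  | Leaf _ => 0
  | Prec U V => (nprec U + nprec V).+1
  | Succ U V => nprec U + nprec V
  end.

Fixpoint coef (K : fieldType) (T : tree) : ratfun K n :=
  match T with
  | Leaf _ => 1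
  | Prec U V => psum K (vars V) * coef K U * coef K V
  | Succ U V => coef K U * coef K V / psum K (vars U)
  end.

End Trees.

Definition Rspace (K : fieldType) (n : nat) : ratfun K n -> Prop :=
  in_span (fun f => exists2 T : tree n, multilinear T & f = coef K T).

Definition Rspace_k (K : fieldType) (n k : nat) : ratfun K n -> Prop :=
  in_span (fun f => exists T : tree n,
    [/\ multilinear T, nprec T = k & f = coef K T]).

Definition setmax (n : nat) (A : {set 'I_n}) : nat := \max_(a in A) (a : nat).

Definition delmax (n : nat) (A : {set 'I_n}) : {set 'I_n} :=
  [set a in A | (a : nat) != setmax A].

Definition monomial_in (n : nat) (A : {set 'I_n}) (d : nat) (m : 'X_{1..n}) :
  Prop := mdeg m = d /\ (forall a, m a != 0%N -> a \in A).

Definition block (n : nat) (I : nat -> {set 'I_n}) (s : nat) : {set 'I_n} :=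
  I s :\: I s.-1.

(* The sequences I, d and M are functions on nat of which only the indices
   0..j+1 (for I) and 1..j+1 (for d and M) are relevant. The equation
   d_1 + ... + d_(j+1) = 2k + j - n + 1 is in nat, with n moved to the left. *)
Definition in_B (K : fieldType) (n k : nat) (f : ratfun K n) : Prop :=
  exists (j : nat) (I : nat -> {set 'I_n}) (d : nat -> nat)
         (M : nat -> 'X_{1..n}),
    [/\ [/\ I 0%N = set0, I j.+1 = setT &
          forall s, (s <= j)%N -> I s \proper I s.+1],
        forall s, (1 <= s <= j.+1)%N ->
          (d s <= #|block I s| - 1)%N /\ d s = #|block I s| - 1 %[mod 2],
        (\sum_(1 <= s < j.+2) d s + n = 2 * k + j + 1)%N,
        (forall s, (1 <= s <= j)%N ->
          monomial_in (delmax (block I s)) (d s) (M s)) /\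
        monomial_in (block I j.+1) (d j.+1) (M j.+1) &
        f = (\prod_(1 <= s < j.+2) ('X_[M s])%:F) /
            \prod_(1 <= s < j.+1) psum K (I s)].

(* Main.v *)
Require Import Defs.
From mathcomp Require Import all_boot all_order all_algebra.
From mathcomp Require Import ring zify.

Set Implicit Arguments.
Unset Strict Implicit.
Unset Printing Implicit Defensive.

(** Write [P_I] for the sum of the variables in [I].  A word is an ordered list
    of disjoint blocks [B_1, ..., B_j, B_(j+1)] covering a given set of
    variables, together with a monomial [M]; its value is [M] divided by the
    product of the sums [P_(B_1 U ... U B_s)] with [s <= j], so that the last
    block contributes no denominator.  The word is admissible if in every block
    the degree of [M] is smaller than the number [#|B_s|] of variables and has
    the same parity as [#|B_s| - 1], and it is reduced if moreover [M] does not
    involve the largest variable of any block but the last.  The elements of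
    the set B of the theorem are the values of reduced words ([in_B_word],
    [word_in_B]).

    Values of words are combinations of tree coefficients.  A [Succ] whose
    right argument carries the last block removes this block
    ([word_tree_span]), which leaves the case of a single block, that is, of a
    monomial of admissible degree ([tree_span_mono]).

    Tree coefficients are combinations of values of words, by induction on the
    tree.  The identity [1 / (P Q) = (1 / P + 1 / Q) / (P + Q)] turns a product
    of two chains of denominators into the sum over their shuffles
    ([chain_inv_shuffle]); the factor [1 / P_U] of a [Succ] just closes the
    last block of the left word, and the factor [P_V] of a [Prec] either
    multiplies the last block or cancels a denominator, which fuses two blocks
    ([words_succ], [words_prec]).  A word in which some block other than the
    last involves its largest variable is then rewritten by expressing that
    variable through two denominators and the rest of the block
    ([words_reduced]).

    Reduced words are linearly independent by a residue argument
    ([reduced_chain_indep]).  Let [J] be a first block of smallest size in a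
    linear relation.  Only the words beginning with [J] have a pole along
    [P_J = 0], and restriction to this hyperplane, on which the variables other
    than the largest one of [J] are independent, deletes [J] from them.  Hence
    a relation between shorter words, and induction applies.

    Blocks are lists of variables and words list their blocks from the last to
    the first.  Denominators are then sums over the suffixes of a list of
    lists, fusion of blocks is concatenation, and in the identities between
    fractions disjointness only serves to keep these sums from vanishing. *)

(** * Linear spans *)
Section Spans.
Import GRing.Theory.
Local Open Scope ring_scope.
Variable K : fieldType.

Lemma mem_span (V : lmodType K) (S : V -> Prop) v : S v -> in_span S v.
Proof.
move=> Sv; exists 1%N, (fun=> 1), (fun=> v).
by split=> //; rewrite big_ord1 scale1r.
Qed.

Lemma span0 (V : lmodType K) (S : V -> Prop) : in_span S 0.
Proof.
by exists 0%N, (fun=> 0), (fun=> 0); split; [case | rewrite big_ord0].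
Qed.

Lemma spanD (V : lmodType K) (S : V -> Prop) u v :
  in_span S u -> in_span S v -> in_span S (u + v).
Proof.
move=> [m [c [x [Sx ->]]]] [m' [c' [x' [Sx' ->]]]].
exists (m + m')%N,
  (fun i => match split i with inl j => c j | inr j => c' j end),
  (fun i => match split i with inl j => x j | inr j => x' j end).
split=> [i|]; first by case: split.
rewrite big_split_ord /=; congr (_ + _); apply: eq_bigr => i _.
  by rewrite (unsplitK (inl i)).
by rewrite (unsplitK (inr i)).
Qed.

Lemma spanZ (V : lmodType K) (S : V -> Prop) a v :
  in_span S v -> in_span S (a *: v).
Proof.
move=> [m [c [x [Sx ->]]]]; exists m, (fun i => a * c i), x; split=> //.
by rewrite scaler_sumr; apply: eq_bigr => i _; rewrite scalerA.
Qed.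

Lemma spanN (V : lmodType K) (S : V -> Prop) v :
  in_span S v -> in_span S (- v).
Proof. by rewrite -scaleN1r; apply: spanZ. Qed.

Lemma spanB (V : lmodType K) (S : V -> Prop) u v :
  in_span S u -> in_span S v -> in_span S (u - v).
Proof. by move=> Su Sv; apply: spanD (spanN _). Qed.

Lemma span_sum (V : lmodType K) (S : V -> Prop) (I : eqType) (r : seq I)
    (P : pred I) (F : I -> V) :
  (forall i, i \in r -> P i -> in_span S (F i)) ->
  in_span S (\sum_(i <- r | P i) F i).
Proof.
move=> SF; rewrite big_seq_cond.
apply: big_rec => [|i v /andP[ri Pi] Sv]; first exact: span0.
by apply: spanD => //; apply: SF.
Qed.

(** Covers both enlarging a spanning set (with [f] the identity) and applying a
    linear map to a span. *)
Lemma span_linear (V W : lmodType K) (f : V -> W) (S : V -> Prop)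
    (S' : W -> Prop) :
  {morph f : u v / u + v} -> (forall a, {morph f : v / a *: v}) ->
  (forall v, S v -> in_span S' (f v)) ->
  forall v, in_span S v -> in_span S' (f v).
Proof.
move=> fD fZ fS v [m [c [x [Sx ->]]]].
have f0 : f 0 = 0 by rewrite -(scale0r (0 : V)) fZ scale0r.
rewrite (big_morph f fD f0); apply: span_sum => i _ _.
by rewrite fZ; apply: spanZ; apply: fS.
Qed.

Lemma span_trans (V : lmodType K) (S S' : V -> Prop) :
  (forall v, S v -> in_span S' v) -> forall v, in_span S v -> in_span S' v.
Proof. by move=> SS'; apply: span_linear. Qed.

End Spans.

(** * Shuffles of inverse partial sums *)
Section ChainFractions.
Import GRing.Theory.
Local Open Scope ring_scope.
Variables (F : fieldType) (I : eqType) (x : I -> F).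

Definition wsum (s : seq I) : F := \sum_(i <- s) x i.

(** Inverse of the product of the partial sums of a chain of blocks, listed from
    the last to the first. *)
Fixpoint chain_inv (L : seq (seq I)) : F :=
  if L is _ :: L' then chain_inv L' / wsum (flatten L) else 1.

Lemma wsum_nil : wsum [::] = 0.
Proof. exact: big_nil. Qed.

Lemma wsum_cons i s : wsum (i :: s) = x i + wsum s.
Proof. exact: big_cons. Qed.

Lemma wsum_cat s t : wsum (s ++ t) = wsum s + wsum t.
Proof. exact: big_cat. Qed.

Lemma perm_wsum s t : perm_eq s t -> wsum s = wsum t.
Proof. exact: perm_big. Qed.

Hypothesis wsum_neq0 : forall s, uniq s -> s != [::] -> wsum s != 0.

Lemma wsum_block_neq0 b (L : seq (seq I)) :
  uniq (flatten (b :: L)) -> [::] \notin b :: L -> wsum (flatten (b :: L)) != 0.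
Proof.
move=> uL; rewrite inE negb_or => /andP[b0 _]; apply: wsum_neq0 => //.
by case: b b0 {uL}.
Qed.

(** The last denominators [P] and [Q] of the two chains are traded for [P + Q]
    by [1 / (P Q) = (1 / P + 1 / Q) / (P + Q)], and in each of the two terms
    one chain has become shorter.  The terms of the final sum are indexed by
    the shuffles of [L1] and [L2], of which only the multiset of blocks is
    recorded, because admissibility and weight depend on nothing else. *)
Lemma chain_inv_shuffle (L1 L2 : seq (seq I)) :
  uniq (flatten (L1 ++ L2)) -> [::] \notin L1 ++ L2 ->
  exists Qs : seq (seq (seq I)),
    (forall Q, Q \in Qs -> perm_eq Q (L1 ++ L2)) /\
    chain_inv L1 * chain_inv L2 = \sum_(Q <- Qs) chain_inv Q.
Proof.
elim: L1 L2 => [|b L1 IH1] L2.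
  move=> _ _; exists [:: L2]; split=> [Q|].
    by rewrite inE => /eqP ->.
  by rewrite big_seq1 mul1r.
elim: L2 => [|c L2 IH2] uL nL.
  exists [:: b :: L1]; rewrite cats0; split=> [Q|].
    by rewrite inE => /eqP ->.
  by rewrite big_seq1 mulr1.
have /IH1 [|Q1 [pQ1 eQ1]] : uniq (flatten (L1 ++ c :: L2)).
  by move: uL; rewrite /= cat_uniq => /and3P[].
  by move: nL; rewrite /= inE negb_or => /andP[].
have pc : perm_eq (b :: L1 ++ c :: L2) (c :: (b :: L1) ++ L2).
  by rewrite -cat_cons perm_catC /= perm_cons perm_catC.
have uc : uniq (flatten (c :: (b :: L1) ++ L2)).
  by rewrite -(perm_uniq (perm_flatten pc)).
have nc : [::] \notin c :: (b :: L1) ++ L2 by rewrite -(perm_mem pc).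
have [||Q2 [pQ2 eQ2]] := IH2.
- by move: uc; rewrite /= cat_uniq => /and3P[].
- by move: nc; rewrite inE negb_or => /andP[].
exists (map (cons b) Q1 ++ map (cons c) Q2); split=> [Q|].
  rewrite mem_cat => /orP[] /mapP[Q' Q'in ->].
    by rewrite /= perm_cons pQ1.
  by rewrite (perm_trans _ (_ : perm_eq (c :: (b :: L1) ++ L2) _)) //
     ?perm_cons ?pQ2 // perm_sym.
set S := wsum (flatten ((b :: L1) ++ c :: L2)).
have wS : S = wsum (flatten (b :: L1)) + wsum (flatten (c :: L2)).
  by rewrite /S flatten_cat wsum_cat.
have uS : uniq (flatten (b :: L1) ++ flatten (c :: L2)).
  by rewrite -flatten_cat.
rewrite big_cat !big_map /=.
have -> : \sum_(j <- Q1) chain_inv j / wsum (b ++ flatten j) =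
          (\sum_(j <- Q1) chain_inv j) / S.
  rewrite mulr_suml !big_seq; apply: eq_bigr => Q /pQ1 pQ.
  congr (_ / _); apply: perm_wsum.
  by rewrite /= perm_cat2l; apply: perm_flatten.
have -> : \sum_(j <- Q2) chain_inv j / wsum (c ++ flatten j) =
          (\sum_(j <- Q2) chain_inv j) / S.
  rewrite mulr_suml !big_seq; apply: eq_bigr => Q /pQ2 pQ.
  congr (_ / _); apply: perm_wsum.
  rewrite perm_sym (perm_trans (perm_flatten pc)) //.
  by rewrite [flatten _]/= perm_cat2l perm_sym; apply: perm_flatten pQ.
rewrite -eQ1 -eQ2 [chain_inv (b :: L1)]/= [chain_inv (c :: L2)]/=.
have S0 : S != 0 by apply: (wsum_block_neq0 uL nL).
have A0 : wsum (b ++ flatten L1) != 0.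
  apply: (@wsum_block_neq0 b L1); first by move: uS; rewrite cat_uniq => /and3P[].
  by move: nL; rewrite mem_cat negb_or => /andP[].
have B0 : wsum (c ++ flatten L2) != 0.
  apply: (@wsum_block_neq0 c L2); first by move: uS; rewrite cat_uniq => /and3P[].
  by move: nL; rewrite mem_cat negb_or => /andP[].
move: S0; rewrite wS /= => S0; field.
by rewrite A0 B0 S0.
Qed.

(** The first block of a word, as listed here, contributes no denominator, so the
    fusion takes place in the whole word while [behead] removes the block that
    does not count; [L0] may be empty. *)
Lemma chain_inv_fuse (L0 L1 : seq (seq I)) d c :
  wsum (flatten (c :: L1)) != 0 ->
  chain_inv (behead (L0 ++ [:: d, c & L1])) * wsum (flatten (c :: L1)) =
  chain_inv (behead (L0 ++ (d ++ c) :: L1)).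
Proof.
move=> c0.
have fuse L : chain_inv (L ++ [:: d, c & L1]) * wsum (flatten (c :: L1)) =
              chain_inv (L ++ (d ++ c) :: L1).
  elim: L => [|b L IH] /=; first by rewrite catA mulrAC divfK.
  by rewrite -IH !flatten_cat /= !catA mulrAC.
case: L0 => [|b L0]; last exact: fuse.
by rewrite /= divfK.
Qed.

End ChainFractions.

(** * Monomials as rational functions *)
Section RationalFunctions.
Import GRing.Theory.
Local Open Scope ring_scope.
Variables (K : fieldType) (n : nat).
Implicit Types (s u v c : seq 'I_n) (m : 'X_{1..n}) (f g h : ratfun K n).

Definition mono m : ratfun K n := tofrac 'X_[m].

Definition frac_sum s : ratfun K n := wsum (fun i => mono U_(i)) s.

Lemma monoD m1 m2 : mono (m1 + m2)%MM = mono m1 * mono m2.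
Proof. by rewrite /mono mpolyXD tofracM. Qed.

Lemma mono0 : mono 0%MM = 1.
Proof. by rewrite /mono mpolyX0 tofrac1. Qed.

Lemma mono_frac_sum m s : mono m * frac_sum s = \sum_(i <- s) mono (m + U_(i))%MM.
Proof.
by rewrite /frac_sum /wsum mulr_sumr; apply: eq_bigr => i _; rewrite monoD.
Qed.

Lemma frac_sumE s : frac_sum s = tofrac (\sum_(i <- s) 'X_i).
Proof. by rewrite /frac_sum /wsum rmorph_sum. Qed.

Lemma psum_frac_sum s : uniq s -> psum K [set i in s] = frac_sum s.
Proof.
move=> us; rewrite frac_sumE /psum; congr (tofrac _).
by rewrite [RHS]big_uniq //=; apply: eq_bigl => i; rewrite inE.
Qed.

Lemma mcoeff_sum_var s a :
  uniq s -> (\sum_(i <- s) 'X_i : {mpoly K[n]})@_U_(a) = (a \in s)%:R.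
Proof.
move=> us; rewrite (big_morph _ (mcoeffD _) (mcoeff0 _ _)).
rewrite (eq_bigr (fun i => (i == a)%:R)) => [|i _]; last by rewrite mcoeffXU.
have [as_|as_] := boolP (a \in s).
  rewrite (bigD1_seq a) //= eqxx big1 ?addr0 // => i /negbTE ->.
  by [].
by rewrite big_seq big1 // => i is_; case: eqP => // ia; rewrite -ia is_ in as_.
Qed.

Lemma frac_sum_neq0 s : uniq s -> s != [::] -> frac_sum s != 0.
Proof.
move=> us; case: s us => // a s us _; rewrite frac_sumE tofrac_eq0.
apply/eqP => /(congr1 (mcoeff U_(a))); rewrite mcoeff_sum_var // mcoeff0.
by rewrite inE eqxx => /eqP; rewrite oner_eq0.
Qed.

Lemma scale_mulr a h f : a *: (h * f) = h * (a *: f).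
Proof. exact: mulrCA. Qed.

Lemma span_mul (S S' S'' : ratfun K n -> Prop) h :
  (forall f g, S f -> S' g -> in_span S'' (h * f * g)) ->
  forall f g, in_span S f -> in_span S' g -> in_span S'' (h * f * g).
Proof.
move=> SS' f g Sf S'g.
apply: (span_linear (f := fun g => h * f * g) (S := S')) => //.
- by move=> ? ?; rewrite mulrDr.
- by move=> a ?; rewrite scale_mulr.
move=> {S'g}g S'g; apply: (span_linear (f := fun f => h * f * g) (S := S)) => //.
- by move=> ? ?; rewrite mulrDr mulrDl.
- by move=> a ?; rewrite -![_ * g]mulrC !scale_mulr.
by move=> {Sf}f Sf; apply: SS'.
Qed.

(** * The spaces spanned by tree coefficients *)

Definition tree_span s k : ratfun K n -> Prop :=
  in_span (fun f => exists T : tree n,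
    [/\ perm_eq (leaves T) s, nprec T = k & f = coef K T]).

Lemma psum_vars (T : tree n) s :
  perm_eq (leaves T) s -> uniq s -> psum K (vars T) = frac_sum s.
Proof.
move=> ps us; rewrite /vars psum_frac_sum ?(perm_uniq ps) //.
exact: perm_wsum.
Qed.

Lemma tree_span_perm s u k f :
  perm_eq s u -> tree_span s k f -> tree_span u k f.
Proof.
move=> su; apply: span_trans => _ [T [pT kT ->]]; apply: mem_span.
by exists T; split=> //; apply: perm_trans su.
Qed.

Lemma tree_span_leaf a : tree_span [:: a] 0 1.
Proof. by apply: mem_span; exists (Leaf a); split=> //=; rewrite perm_refl. Qed.

Lemma tree_span_prec u v k l f g :
  uniq (u ++ v) -> tree_span u k f -> tree_span v l g ->
  tree_span (u ++ v) (k + l).+1 (frac_sum v * f * g).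
Proof.
move=> uuv; apply: span_mul => _ _ [T [pT <- ->]] [T' [pT' <- ->]].
apply: mem_span; exists (Prec T T'); split=> //=; first exact: perm_cat.
have uv : uniq v by move: uuv; rewrite cat_uniq => /and3P[].
by rewrite (psum_vars pT' uv).
Qed.

Lemma tree_span_succ u v k l f g :
  uniq (u ++ v) -> tree_span u k f -> tree_span v l g ->
  tree_span (u ++ v) (k + l) ((frac_sum u)^-1 * f * g).
Proof.
move=> uuv; apply: span_mul => _ _ [T [pT <- ->]] [T' [pT' <- ->]].
apply: mem_span; exists (Succ T T'); split=> //=; first exact: perm_cat.
have uu : uniq u by move: uuv; rewrite cat_uniq => /and3P[].
by rewrite (psum_vars pT uu) -mulrA mulrC.
Qed.

(** * Monomials of admissible degree *)

Definition supported m s := forall a, m a != 0%N -> a \in s.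

Lemma supported_perm m s u : perm_eq s u -> supported m s -> supported m u.
Proof. by move=> su sm a /sm; rewrite (perm_mem su). Qed.

Lemma supported_le m m' s :
  (forall a, (m' a <= m a)%N) -> supported m s -> supported m' s.
Proof. by move=> le sm a m'a; apply: sm; have := le a; lia. Qed.

Lemma supportedU m (c : 'I_n) s : c \in s -> supported m s -> supported (m + U_(c))%MM s.
Proof.
move=> cs sm a; rewrite mnmDE addn_eq0 mnm1E negb_and.
by case: (eqVneq c a) => [<- //|_]; rewrite orbF; apply: sm.
Qed.

Definition deg s m : nat := (\sum_(i <- s) m i)%N.

Lemma degD s m1 m2 : deg s (m1 + m2)%MM = (deg s m1 + deg s m2)%N.
Proof. by rewrite /deg -big_split; apply: eq_bigr => i _; rewrite mnmDE. Qed.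

Lemma deg_cat s u m : deg (s ++ u) m = (deg s m + deg u m)%N.
Proof. exact: big_cat. Qed.

Lemma deg_eq0 s m : (forall a, a \in s -> m a = 0%N) -> deg s m = 0%N.
Proof. by move=> sm; rewrite /deg big_seq big1. Qed.

Lemma deg1 s a : uniq s -> deg s U_(a)%MM = (a \in s).
Proof.
move=> us; rewrite /deg; have [as_|as_] := boolP (a \in s).
  rewrite (bigD1_seq a) //= mnm1E eqxx big1 // => i /negbTE ia.
  by rewrite mnm1E eq_sym ia.
apply: deg_eq0 => i is_; rewrite mnm1E; case: eqP => // ai.
by rewrite ai is_ in as_.
Qed.

Lemma deg_mdeg s m : uniq s -> supported m s -> deg s m = mdeg m.
Proof.
move=> us sm; rewrite mdegE /deg big_uniq //= [RHS](bigID (mem s)) /= [X in (_ + X)%N]big1 ?addn0 //.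
by move=> a as_; apply/eqP; apply: contraNT as_; apply: sm.
Qed.

Lemma exists_missing_var s m :
  uniq s -> supported m s -> (mdeg m < size s)%N ->
  exists2 a, a \in s & m a = 0%N.
Proof.
move=> us sm; rewrite -(deg_mdeg us sm) => lt.
case: (altP (@hasP _ (fun a => m a == 0%N) s)) => [[a ? /eqP ?]|].
  by exists a.
rewrite -all_predC => /allP no; move: lt; rewrite ltnNge.
rewrite -sum1_size /deg big_seq [X in (_ <= X)%N]big_seq.
by rewrite leq_sum // => i /no /=; rewrite lt0n.
Qed.

Lemma mnm_subU m e : m e != 0%N -> m = (m - U_(e) + U_(e))%MM.
Proof. by move=> me; rewrite submK // lep1mP. Qed.

(** In top degree [size s - 1], a variable of exponent one can be split off by
    [Prec].  A larger exponent of [e] is lowered by another [Prec]: if [a] does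
    not occur in [m], multiply [m / x_e] by the sum of all variables but [a];
    among the resulting monomials only [m] itself has the exponent [m e] at
    [e].  In lower degree, a variable [b] that does not occur in [m] is made
    the right argument of a [Succ]; its left part contributes [m] times the sum
    of the other variables, which the [Succ] divides out. *)
Lemma tree_span_mono s m k :
  uniq s -> supported m s -> (mdeg m < size s)%N ->
  (mdeg m + size s = k.*2.+1)%N -> tree_span s k (mono m).
Proof.
have [N] := ubnP (size s); elim: N s m k => // N IH s m k.
rewrite ltnS => sN us sm lts dk.
have rem_spec (b : 'I_n) (t : seq 'I_n) : b \in s -> t = rem b s ->
    [/\ perm_eq (t ++ [:: b]) s, uniq (t ++ [:: b]), uniq t & size s = (size t).+1].
  move=> bs ->; have p : perm_eq (rem b s ++ [:: b]) s.
    by rewrite cats1 perm_rcons perm_sym perm_to_rem.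
  split=> //; first by rewrite (perm_uniq p).
    exact: rem_uniq.
  by rewrite -(perm_size p) size_cat addn1.
have suppB b m' : m' b = 0%N -> (forall a, (m' a <= m a)%N) ->
    supported m' (rem b s).
  move=> m'b le a m'a; rewrite mem_rem_uniq // inE; apply/andP; split.
    by apply: contraNneq m'a => ->; rewrite m'b.
  exact: (supported_le le sm).
have [top|low] := eqVneq (mdeg m).+1 (size s); last first.
  have [b bs mb] := exists_missing_var us sm lts.
  have [pt ut u1 st] := rem_spec b _ bs erefl; set t : seq 'I_n := rem b s in pt ut u1 st.
  apply: (tree_span_perm pt).
  have t0 : t != [::] by apply/eqP => t0; rewrite t0 /= in st; move/eqP: low; lia.
  have -> : mono m = (frac_sum t)^-1 * (mono m * frac_sum t) * 1.
    by rewrite mulr1 mulrCA mulVf ?mulr1 // frac_sum_neq0.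
  rewrite -[k]addn0; apply: tree_span_succ (tree_span_leaf b) => //.
  rewrite mono_frac_sum; apply: span_sum => c ct _.
  apply: IH; rewrite ?mdegD ?mdeg1 //; try lia.
  by apply: supportedU => //; apply: (suppB b m).
have [m0|[e me]] : m = 0%MM \/ exists e, m e != 0%N.
  case: (pickP (fun e => m e != 0%N)) => [e ?|no]; first by right; exists e.
  by left; apply/mnmP => e; have /negbFE/eqP := no e; rewrite mnm0E.
  move: top dk; rewrite m0 mdeg0; case: s {sN us sm lts rem_spec suppB} => // a [|//] _.
  by rewrite mono0; case: k => // _; apply: tree_span_leaf.
have [t met] : exists t, m e = t.+1 by exists (m e).-1; rewrite prednK ?lt0n.
elim: t m sm lts dk suppB top me met => [|t IHt] m sm lts dk suppB top me met.
  have es := sm e me.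
  have [pt ut u1 st] := rem_spec e _ es erefl; set s' : seq 'I_n := rem e s in pt ut u1 st.
  apply: (tree_span_perm pt).
  have mE := mnm_subU me; set m' := (m - U_(e))%MM in mE.
  have dm : mdeg m = (mdeg m').+1 by rewrite mE mdegD mdeg1 addn1.
  have k0 : (0 < k)%N by lia.
  rewrite -(prednK k0) -[k.-1]addn0 mE monoD.
  have -> : mono m' * mono U_(e) = frac_sum [:: e] * mono m' * 1.
    by rewrite /frac_sum /wsum big_seq1 mulr1 mulrC.
  apply: tree_span_prec (tree_span_leaf e) => //.
  apply: IH => //; try lia.
  by apply: suppB => [|a]; rewrite mnmBE ?leq_subr // met mnm1E eqxx.
have mE := mnm_subU me; set m' := (m - U_(e))%MM in mE.
have dm : mdeg m = (mdeg m').+1 by rewrite mE mdegD mdeg1 addn1.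
have m'le a : (m' a <= m a)%N by rewrite mnmBE leq_subr.
have m'e : m' e = t.+1 by rewrite mnmBE met mnm1E eqxx subn1.
have [a as_ ma] := exists_missing_var us sm lts.
have [pt ut u1 st] := rem_spec a _ as_ erefl; set v : seq 'I_n := rem a s in pt ut u1 st.
have ev : e \in v.
  by rewrite mem_rem_uniq // inE sm // andbT; apply/eqP => ea; rewrite -ea met in ma.
have k0 : (0 < k)%N by lia.
have -> : mono m = frac_sum v * 1 * mono m' -
                   \sum_(c <- v | c != e) mono (m' + U_(c))%MM.
  by rewrite mulr1 mulrC mono_frac_sum (bigD1_seq e) //= -mE addrK.
apply: spanB.
  have pt' : perm_eq ([:: a] ++ v) s by rewrite perm_catC.
  apply: (tree_span_perm pt').
  rewrite -(prednK k0) -[k.-1]add0n.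
  apply: tree_span_prec (tree_span_leaf a) _.
    by rewrite (perm_uniq pt').
  apply: IH => //; try lia.
  apply: suppB => //; apply/eqP; rewrite -leqn0 -ma; exact: m'le.
apply: span_sum => c cv ce.
have cs : c \in s by rewrite (mem_rem cv).
have dm' : mdeg (m' + U_(c))%MM = mdeg m by rewrite mdegD mdeg1 addn1.
have sm' : supported (m' + U_(c))%MM s.
  by apply: supportedU => //; apply: supported_le sm.
have m'ce : (m' + U_(c))%MM e = t.+1.
  by rewrite mnmDE m'e mnm1E (negbTE ce) addn0.
apply: IHt => //; rewrite ?dm' ?m'ce //.
move=> b m2 m2b le2 i m2i; rewrite mem_rem_uniq // inE; apply/andP; split.
  by apply: contraNneq m2i => ->; rewrite m2b.
exact: (supported_le le2 sm').
Qed.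

End RationalFunctions.

(** * Block words *)
Section BlockWords.
Import GRing.Theory.
Local Open Scope ring_scope.
Variables (K : fieldType) (n : nat).
Implicit Types (s u v b c d : seq 'I_n) (L Q : seq (seq 'I_n)).
Implicit Types (m : 'X_{1..n}) (f g : ratfun K n).

Local Notation mono := (@mono K n).
Local Notation frac_sum := (@frac_sum K n).
Local Notation chain_inv := (chain_inv (fun i => mono U_(i))).

(** As the parity condition is [deg c m = size c - 1] modulo 2, the sum
    [deg c m + size c] is odd, and its half rounded down counts the occurrences
    of [Prec] in the trees that span the block. *)
Definition admissible m c := (deg c m < size c)%N && odd (deg c m + size c).

Definition weight m L : nat := (\sum_(c <- L) (deg c m + size c)./2)%N.

Definition is_word s m L :=
  [/\ perm_eq (flatten L) s, all (admissible m) L & supported m s].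

(** The head of [L] is the last block, which contributes no denominator. *)
Definition word_value m L : ratfun K n := mono m * chain_inv (behead L).

Definition words s k f := exists m b L,
  [/\ is_word s m (b :: L), weight m (b :: L) = k & f = word_value m (b :: L)].

Lemma eq_deg m m' c : {in c, m =1 m'} -> deg c m = deg c m'.
Proof. by move=> mm'; rewrite /deg big_seq [RHS]big_seq; apply: eq_bigr. Qed.

Lemma eq_admissible m m' c : {in c, m =1 m'} -> admissible m c = admissible m' c.
Proof. by move=> mm'; rewrite /admissible (eq_deg mm'). Qed.

Lemma in_block L c i :
  c \in L -> i \in c -> i \in flatten L.
Proof. by move=> cL ic; apply/flattenP; exists c. Qed.

Lemma eq_in_admissible m m' L :
  {in flatten L, m =1 m'} -> all (admissible m) L = all (admissible m') L.
Proof.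
move=> mm'; apply: eq_in_all => c cL; apply: eq_admissible => i ic.
exact/mm'/(in_block cL).
Qed.

Lemma eq_in_weight m m' L :
  {in flatten L, m =1 m'} -> weight m L = weight m' L.
Proof.
move=> mm'; rewrite /weight big_seq [RHS]big_seq; apply: eq_bigr => c cL.
rewrite (@eq_deg m m') // => i ic; exact/mm'/(in_block cL).
Qed.

Lemma weight_cat m L1 L2 : weight m (L1 ++ L2) = (weight m L1 + weight m L2)%N.
Proof. exact: big_cat. Qed.

Lemma weight_cons m c L :
  weight m (c :: L) = ((deg c m + size c)./2 + weight m L)%N.
Proof. exact: big_cons. Qed.

Lemma admissible_nonempty m L : all (admissible m) L -> [::] \notin L.
Proof.
move=> /allP aL; apply/negP => /aL.
by rewrite /admissible ltn0 andFb.
Qed.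

Lemma word_block_sum_neq0 s m L0 c L :
  uniq s -> is_word s m (L0 ++ c :: L) -> frac_sum (flatten (c :: L)) != 0.
Proof.
move=> us [pL aL _]; apply: frac_sum_neq0.
  by move: us; rewrite -(perm_uniq pL) flatten_cat cat_uniq => /and3P[].
move: aL; rewrite all_cat /= => /and3P[_ ac _].
by case: c ac {pL} => //; rewrite /admissible ltn0 andFb.
Qed.

(** ** Words have values in the tree spans *)

Definition restrict s m : 'X_{1..n} := [multinom (if i \in s then m i else 0%N) | i < n].

Lemma restrictE s m : {in s, m =1 restrict s m}.
Proof. by move=> i is_; rewrite mnmE is_. Qed.

Lemma supported_restrict s m : supported (restrict s m) s.
Proof. by move=> i; rewrite mnmE; case: ifP. Qed.

Lemma restrict_cat u v m :
  uniq (u ++ v) -> supported m (u ++ v) -> m = (restrict u m + restrict v m)%MM.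
Proof.
rewrite cat_uniq => /and3P[_ /hasPn uv _] sm.
apply/mnmP => i; rewrite mnmDE !mnmE.
have := sm i; rewrite mem_cat; case: (boolP (i \in u)) => iu.
  by case: (boolP (i \in v)) => [/uv /=|_ _]; [rewrite iu | rewrite addn0].
by case: (boolP (i \in v)) => //= _; case: (m i) => // k /(_ isT).
Qed.

Lemma admissible_tree_span c m :
  uniq c -> supported m c -> admissible m c ->
  tree_span c (deg c m + size c)./2 (mono m).
Proof.
move=> uc sm /andP[lt od]; rewrite deg_mdeg // in lt od *.
by apply: tree_span_mono => //; lia.
Qed.

(** The last block is the right argument of a [Succ], the left argument of
    which realises the shorter word. *)
Lemma word_tree_span s m L :
  uniq s -> L != [::] -> is_word s m L ->
  tree_span s (weight m L) (word_value m L).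
Proof.
elim: L s m => // b [_|c L IH] s m us _ [pL aL sm].
  rewrite /word_value /weight big_seq1 mulr1.
  move: aL; rewrite /= andbT => ab; move: pL; rewrite /= cats0 => pb.
  apply: (tree_span_perm pb); apply: admissible_tree_span => //.
    by rewrite (perm_uniq pb).
  by apply: supported_perm sm; rewrite perm_sym.
set L' := c :: L in IH pL aL *; set v := flatten L'.
have pv : perm_eq (v ++ b) s by rewrite perm_catC.
have uv : uniq (v ++ b) by rewrite (perm_uniq pv).
have sv : supported m (v ++ b) by apply: supported_perm sm; rewrite perm_sym.
apply: (tree_span_perm pv).
move: aL => /= /andP[ab aL'].
have := restrict_cat uv sv; set m1 := restrict v m; set m2 := restrict b m => mE.
have -> : word_value m (b :: L') =
          (frac_sum v)^-1 * word_value m1 L' * mono m2.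
  rewrite /word_value [behead (b :: L')]/= {1}mE monoD [chain_inv L']/=.
  rewrite [behead L']/= -/(flatten L') -/v -/(frac_sum v); set V := _^-1; ring.
rewrite weight_cons addnC.
have [uv1 ub] : uniq v /\ uniq b by move: uv; rewrite cat_uniq => /and3P[].
apply: tree_span_succ => //; last first.
  rewrite (eq_deg (@restrictE b m)); apply: admissible_tree_span => //.
    exact: supported_restrict.
  by rewrite -(eq_admissible (@restrictE b m)).
rewrite (eq_in_weight (@restrictE v m)); apply: IH => //; split=> //.
  by rewrite -(eq_in_admissible (@restrictE v m)).
exact: supported_restrict.
Qed.

(** ** Operations on words *)

Lemma word_join u v m1 m2 L1 L2 L :
  uniq (u ++ v) -> is_word u m1 L1 -> is_word v m2 L2 -> perm_eq L (L1 ++ L2) ->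
  is_word (u ++ v) (m1 + m2)%MM L /\
  weight (m1 + m2)%MM L = (weight m1 L1 + weight m2 L2)%N.
Proof.
rewrite cat_uniq => /and3P[_ /hasPn uv _] [p1 a1 s1] [p2 a2 s2] pL.
have e1 : {in flatten L1, m1 =1 (m1 + m2)%MM}.
  move=> i; rewrite (perm_mem p1) => iu; rewrite mnmDE.
  have [->|/s2 /uv /=] := eqVneq (m2 i) 0%N; first by rewrite addn0.
  by rewrite iu.
have e2 : {in flatten L2, m2 =1 (m1 + m2)%MM}.
  move=> i; rewrite (perm_mem p2) => /uv /= iu; rewrite mnmDE.
  by have [->|/s1] := eqVneq (m1 i) 0%N; rewrite ?(negbTE iu).
split; last first.
  by rewrite {1}/weight (perm_big _ pL) big_cat (eq_in_weight e1) (eq_in_weight e2).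
split.
- rewrite (perm_trans (perm_flatten pL)) // flatten_cat; exact: perm_cat.
- by rewrite (perm_all _ pL) all_cat -(eq_in_admissible e1) -(eq_in_admissible e2) a1.
- move=> i; rewrite mnmDE addn_eq0 negb_and mem_cat.
  by case/orP => [/s1 -> //|/s2 ->]; rewrite orbT.
Qed.

Lemma word_in_block s m L c : is_word s m L -> c \in L -> {subset c <= s}.
Proof.
by move=> [pL _ _] cL i ic; rewrite -(perm_mem pL) (in_block cL).
Qed.

Lemma addU_outside s m L0 d c L1 i :
  uniq s -> is_word s m (L0 ++ [:: d, c & L1]) -> i \in d ++ c ->
  {in flatten (L0 ++ L1), m =1 (m + U_(i))%MM}.
Proof.
move=> us [pL _ _] idc a; rewrite mnmDE mnm1E.
have : uniq (d ++ c ++ flatten (L0 ++ L1)).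
  rewrite -(perm_uniq pL) in us; apply: etrans us; apply: perm_uniq.
  by rewrite !flatten_cat /= (catA d c (_ ++ _)) (catA d c (flatten L1)) perm_catCA.
rewrite catA cat_uniq => /and3P[_ /hasPn /(_ a) dis _] aL.
case: eqVneq => [ia|_]; last by rewrite addn0.
by move: (dis aL); rewrite /= -ia idc.
Qed.

(** For two admissible blocks the numbers [deg + size] are odd, so their sum is
    even and the union is admissible only after the degree has changed by one.
    Raising the degree adds one to the weight, and lowering it, as in
    [fuse_down], leaves the weight unchanged. *)
Lemma fuse_up s m L0 d c L1 i :
  uniq s -> is_word s m (L0 ++ [:: d, c & L1]) -> i \in d ++ c ->
  is_word s (m + U_(i))%MM (L0 ++ (d ++ c) :: L1) /\
  weight (m + U_(i))%MM (L0 ++ (d ++ c) :: L1) =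
  (weight m (L0 ++ [:: d, c & L1])).+1.
Proof.
move=> us w idc; have out := addU_outside us w idc; case: w => pL aL sm.
have is_ : i \in s.
  rewrite -(perm_mem pL) flatten_cat mem_cat /= catA mem_cat idc.
  by rewrite orbT.
have udc : uniq (d ++ c).
  move: us; rewrite -(perm_uniq pL) flatten_cat /= (catA d) cat_uniq => /and3P[_ _].
  by rewrite cat_uniq => /and3P[].
have ddc : deg (d ++ c) (m + U_(i))%MM = (deg d m + deg c m).+1.
  by rewrite degD deg1 // idc deg_cat addn1.
move: aL; rewrite all_cat /= => /and4P[a0 ad ac a1].
have out0 : {in flatten L0, m =1 (m + U_(i))%MM}.
  by move=> a aL; apply: out; rewrite flatten_cat mem_cat aL.
have out1 : {in flatten L1, m =1 (m + U_(i))%MM}.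
  by move=> a aL; apply: out; rewrite flatten_cat mem_cat aL orbT.
case/andP: ad => ltd od; case/andP: ac => ltc oc.
split; last first.
  rewrite !weight_cat !weight_cons -(eq_in_weight out0) -(eq_in_weight out1) ddc.
  by rewrite size_cat; lia.
split.
- by move: pL; rewrite !flatten_cat /= (catA d).
- rewrite all_cat /= -(eq_in_admissible out0) -(eq_in_admissible out1) a0 a1.
  by rewrite /admissible ddc size_cat andbT; lia.
- exact: supportedU.
Qed.

Lemma fuse_down s m L0 d c L1 i :
  uniq s -> is_word s (m + U_(i))%MM (L0 ++ [:: d, c & L1]) -> i \in d ++ c ->
  is_word s m (L0 ++ (d ++ c) :: L1) /\
  weight m (L0 ++ (d ++ c) :: L1) =
  weight (m + U_(i))%MM (L0 ++ [:: d, c & L1]).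
Proof.
move=> us w idc; have outs := addU_outside us w idc; case: w => pL aL sm.
have out : {in flatten (L0 ++ L1), m =1 (m + U_(i))%MM}.
  move=> a /outs; rewrite !mnmDE; lia.
have udc : uniq (d ++ c).
  move: us; rewrite -(perm_uniq pL) flatten_cat /= (catA d) cat_uniq => /and3P[_ _].
  by rewrite cat_uniq => /and3P[].
have ddc : (deg d (m + U_(i))%MM + deg c (m + U_(i))%MM = (deg (d ++ c) m).+1)%N.
  by rewrite -deg_cat degD deg1 // idc addn1.
move: aL; rewrite all_cat /= => /and4P[a0 ad ac a1].
have out0 : {in flatten L0, m =1 (m + U_(i))%MM}.
  by move=> a aL; apply: out; rewrite flatten_cat mem_cat aL.
have out1 : {in flatten L1, m =1 (m + U_(i))%MM}.
  by move=> a aL; apply: out; rewrite flatten_cat mem_cat aL orbT.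
case/andP: ad => ltd od; case/andP: ac => ltc oc.
split; last first.
  rewrite !weight_cat !weight_cons -(eq_in_weight out0) -(eq_in_weight out1).
  by rewrite size_cat; lia.
split.
- by move: pL; rewrite !flatten_cat /= (catA d).
- rewrite all_cat /= (eq_in_admissible out0) (eq_in_admissible out1) a0 a1.
  by rewrite /admissible size_cat andbT; lia.
- by apply: supported_le sm => a; rewrite mnmDE leq_addr.
Qed.

(** ** Products of words *)

(** Dividing by [P_u] turns the first word into a complete chain; shuffling it
    with the denominators of the second word keeps the last block [c] of the
    latter at the end. *)
Lemma words_succ u v k l f g :
  uniq (u ++ v) -> words u k f -> words v l g ->
  in_span (words (u ++ v) (k + l)) ((frac_sum u)^-1 * f * g).
Proof.
move=> uuv [m1 [b [L1 [w1 <- ->]]]] [m2 [c [L2 [w2 <- ->]]]].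
have pu : perm_eq (flatten (b :: L1)) u by case: w1.
have join L := word_join (L := L) uuv w1 w2.
have pc : perm_eq (c :: (b :: L1) ++ L2) ((b :: L1) ++ c :: L2).
  by rewrite -(cat1s c L2) -(cat1s c (_ ++ _)) perm_catCA.
have [wc _] := join _ pc.
have [pfc ac _] := wc.
have uc : uniq (flatten (c :: (b :: L1) ++ L2)) by rewrite (perm_uniq pfc).
have [||Qs [pQ eQ]] := chain_inv_shuffle (@frac_sum_neq0 K n) (L1 := b :: L1) (L2 := L2).
- by move: uc; rewrite [flatten _]/= cat_uniq => /and3P[].
- by move: (admissible_nonempty ac); rewrite inE negb_or => /andP[].
have -> : (frac_sum u)^-1 * word_value m1 (b :: L1) * word_value m2 (c :: L2) =
          \sum_(Q <- Qs) word_value (m1 + m2)%MM (c :: Q).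
  rewrite /word_value /= -mulr_sumr -eQ monoD [chain_inv (b :: L1)]/=.
  rewrite -[frac_sum u](perm_wsum _ pu).
  set A := mono m1; set B := mono m2; set C := wsum _ _.
  set D1 := chain_inv L1; set D2 := chain_inv L2.
  by rewrite -[D1 / C]mulrC; ring.
apply: span_sum => Q /pQ {}pQ _; apply: mem_span; exists (m1 + m2)%MM, c, Q.
have [wQ tQ] : is_word (u ++ v) (m1 + m2)%MM (c :: Q) /\
    weight (m1 + m2)%MM (c :: Q) = (weight m1 (b :: L1) + weight m2 (c :: L2))%N.
  by apply: join; apply: perm_trans pc; rewrite perm_cons.
by split.
Qed.

(** The factor [P_v] is the sum of the last block [c] of the second word and of
    its other blocks.  The former is absorbed by the last block [b ++ c] of the
    product; the latter cancels the last denominator of the second word, so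
    that its last two blocks are fused as well. *)
Lemma words_prec u v k l f g :
  uniq (u ++ v) -> words u k f -> words v l g ->
  in_span (words (u ++ v) (k + l).+1) (frac_sum v * f * g).
Proof.
move=> uuv [m1 [b [L1 [w1 <- ->]]]] [m2 [c [L2 [w2 <- ->]]]].
have pv : perm_eq (flatten (c :: L2)) v by case: w2.
have join L := word_join (L := L) uuv w1 w2.
have pc : perm_eq [:: b, c & L1 ++ L2] ((b :: L1) ++ c :: L2).
  by rewrite /= perm_cons -(cat1s c L2) -(cat1s c (_ ++ _)) perm_catCA.
have [wc _] := join _ pc.
have [pfc ac _] := wc.
have uc : uniq (flatten [:: b, c & L1 ++ L2]) by rewrite (perm_uniq pfc).
have uL : uniq (flatten (L1 ++ L2)).
  by move: uc; rewrite [flatten _]/= catA cat_uniq => /and3P[].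
have nL : [::] \notin L1 ++ L2.
  by move: (admissible_nonempty ac); rewrite !inE !negb_or => /and3P[].
have -> : frac_sum v * word_value m1 (b :: L1) * word_value m2 (c :: L2) =
    mono (m1 + m2)%MM * frac_sum c * (chain_inv L1 * chain_inv L2) +
    mono (m1 + m2)%MM * (chain_inv L1 * (chain_inv L2 * frac_sum (flatten L2))).
  rewrite /word_value /= monoD -[frac_sum v](perm_wsum _ pv) [flatten _]/= wsum_cat.
  rewrite -!/(frac_sum _); ring.
have c0 : c != [::].
  by move: (admissible_nonempty ac); rewrite !inE !negb_or => /and3P[_ + _]; rewrite eq_sym.
apply: spanD.
  have [Qs [pQ ->]] := chain_inv_shuffle (@frac_sum_neq0 K n) uL nL.
  rewrite mono_frac_sum mulr_suml; apply: span_sum => i ic _.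
  rewrite mulr_sumr; apply: span_sum => Q /pQ {}pQ _; apply: mem_span.
  exists (m1 + m2 + U_(i))%MM, (b ++ c), Q.
  have [wQ tQ] := join [:: b, c & Q] (perm_trans (perm_cat (perm_refl [:: b; c]) pQ) pc).
  have [|wF tF] := fuse_up (L0 := [::]) (i := i) uuv wQ; first by rewrite mem_cat ic orbT.
  by split; rewrite // tF tQ.
case: L2 pc ac uc uL nL w2 pv join {wc pfc} => [|c' L2] pc ac uc uL nL w2 pv join.
  by rewrite /frac_sum wsum_nil !mulr0; apply: span0.
have s0 : frac_sum (flatten (c' :: L2)) != 0.
  apply: frac_sum_neq0.
    by move: uL; rewrite flatten_cat cat_uniq => /and3P[].
  by move: nL; rewrite mem_cat inE !negb_or eq_sym => /and3P[_ + _]; case: (c').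
rewrite [chain_inv (c' :: L2)]/= divfK //.
have pc' : perm_eq [:: c' & L1 ++ L2] (L1 ++ c' :: L2).
  by rewrite -(cat1s c' L2) -(cat1s c' (_ ++ _)) perm_catCA.
have pcc : perm_eq [:: b, c, c' & L1 ++ L2] ((b :: L1) ++ [:: c, c' & L2]).
  by apply: perm_trans pc; rewrite !perm_cons.
have uL' : uniq (flatten (L1 ++ L2)).
  by move: uL; rewrite -(perm_uniq (perm_flatten pc')) /= cat_uniq => /and3P[].
have nL' : [::] \notin L1 ++ L2.
  by move: nL; rewrite -(perm_mem pc') inE negb_or => /andP[].
have [Qs [pQ ->]] := chain_inv_shuffle (@frac_sum_neq0 K n) uL' nL'.
rewrite mulr_sumr; apply: span_sum => Q /pQ {}pQ _; apply: mem_span.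
exists (m1 + m2)%MM, ((b ++ c) ++ c'), Q.
have [wQ tQ] := join [:: b, c, c' & Q] (perm_trans (perm_cat (perm_refl [:: b; c; c']) pQ) pcc).
(* Three blocks are fused with no change of the monomial: the exponent of some
   [i] in [c] is raised at the first fusion and lowered at the second. *)
case: c c0 {uc ac pc pv w2 join pcc} wQ tQ => // i c _ wQ tQ.
have ibc : i \in b ++ i :: c by rewrite mem_cat inE eqxx orbT.
have [wF tF] := fuse_up (L0 := [::]) uuv wQ ibc.
have [|wG tG] := fuse_down (L0 := [::]) uuv wF (i := i).
  by rewrite mem_cat ibc.
by split; rewrite // tG tF tQ.
Qed.

Lemma coef_words (T : tree n) :
  uniq (leaves T) -> in_span (words (leaves T) (nprec T)) (coef K T).
Proof.
elim: T => [a|U IHU V IHV|U IHU V IHV] /= uT.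
- apply: mem_span; exists 0%MM, [:: a], [::].
  rewrite /word_value /= mono0 mulr1 /weight big_seq1 /is_word /= /admissible.
  have d0 : deg [:: a] 0%MM = 0%N by rewrite deg_eq0 // => i _; rewrite mnm0E.
  rewrite d0; split=> //; split=> // i; by rewrite mnm0E.
- have [uU _ uV] := and3P (etrans (esym (cat_uniq _ _)) uT).
  rewrite psum_frac_sum //; apply: span_mul (IHU uU) (IHV uV) => f g.
  exact: words_prec.
- have [uU _ uV] := and3P (etrans (esym (cat_uniq _ _)) uT).
  rewrite psum_frac_sum // mulrC mulrA; apply: span_mul (IHU uU) (IHV uV) => f g.
  exact: words_succ.
Qed.

End BlockWords.

(** * Reduced words *)
Section ReducedWords.
Import GRing.Theory.
Local Open Scope ring_scope.
Variables (K : fieldType) (n : nat).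
Implicit Types (s u v b c d : seq 'I_n) (L Q : seq (seq 'I_n)).
Implicit Types (m : 'X_{1..n}) (f g : ratfun K n) (a e : 'I_n).

Local Notation mono := (@mono K n).
Local Notation frac_sum := (@frac_sum K n).
Local Notation chain_inv := (chain_inv (fun i => mono U_(i))).
Local Notation word_value := (@word_value K n).

(** The exponent of the largest variable of [c]: without repetitions in [c], the
    sum has one term. *)
Definition topdeg m c : nat :=
  (\sum_(i <- c | all (fun j : 'I_n => j <= i)%N c) m i)%N.

Definition reduced m L := all (fun c => topdeg m c == 0%N) L.

Definition reduced_words s k f := exists m b L,
  [/\ is_word s m (b :: L), reduced m L, weight m (b :: L) = k
    & f = word_value m (b :: L)].

Lemma uniq_flatten_block L c d e :
  uniq (flatten L) -> c \in L -> d \in L -> e \in c -> e \in d -> c = d.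
Proof.
elim: L => // b L IH; rewrite /= cat_uniq !inE => /and3P[_ /hasPn dis uL].
have out c' : c' \in L -> e \in c' -> e \notin b.
  by move=> c'L ec'; apply: dis; apply: in_block ec'.
case/predU1P=> [->|cL] /predU1P[->|dL] // ec ed.
- by have := out d dL ed; rewrite ec.
- by have := out c cL ec; rewrite ed.
- exact: IH.
Qed.

Lemma topdeg_neq0 m c :
  topdeg m c != 0%N ->
  exists e, [/\ e \in c, all (fun j : 'I_n => j <= e)%N c & m e != 0%N].
Proof.
rewrite /topdeg => ne0.
have /hasP[e ec /andP[te me]] :
    has (fun e => all (fun j : 'I_n => j <= e)%N c && (m e != 0%N)) c.
  apply: contraNT ne0; rewrite -all_predC => /allP no.
  rewrite big_seq_cond big1 // => i /andP[ic ti].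
  by have := no i ic; rewrite /= ti /= negbK => /eqP.
by exists e.
Qed.

Lemma topdegD m1 m2 c : topdeg (m1 + m2)%MM c = (topdeg m1 c + topdeg m2 c)%N.
Proof. by rewrite /topdeg -big_split; apply: eq_bigr => i _; rewrite mnmDE. Qed.

Lemma topdeg_swap m L c e a :
  uniq (flatten L) -> c \in L -> e \in c -> a \in c -> a != e ->
  all (fun j : 'I_n => j <= e)%N c ->
  (\sum_(d <- L) topdeg (m + U_(a))%MM d < \sum_(d <- L) topdeg (m + U_(e))%MM d)%N.
Proof.
move=> uL cL ec ac ae te.
have -> : (\sum_(d <- L) topdeg (m + U_(a))%MM d = \sum_(d <- L) topdeg m d)%N.
  rewrite big_seq [RHS]big_seq; apply: eq_bigr => d dL.
  rewrite topdegD [X in (_ + X)%N]big1_seq ?addn0 // => i /andP[ti id].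
  rewrite mnm1E; case: eqP => // ai; rewrite -{i}ai in ti id.
  have cd := uniq_flatten_block uL cL dL ac id; rewrite -cd in ti.
  case/negP: ae; apply/eqP/val_inj/eqP; rewrite eqn_leq.
  by rewrite (allP te a ac) (allP ti e ec).
under [X in (_ < X)%N]eq_bigr do rewrite topdegD.
rewrite big_split /= -[X in (X < _)%N]addn0 ltn_add2l.
rewrite (big_rem c) //= addn_gt0; apply/orP; left.
by rewrite /topdeg (big_rem e) //= te mnm1E eqxx.
Qed.

(** Exchanging a variable of the monomial within its block affects neither
    degrees nor weight, and if the largest variable is replaced, [topdeg]
    decreases by [topdeg_swap]. *)
Lemma word_swap s m L c e a :
  uniq s -> is_word s (m + U_(e))%MM L -> c \in L -> e \in c -> a \in c ->
  is_word s (m + U_(a))%MM L /\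
  weight (m + U_(a))%MM L = weight (m + U_(e))%MM L.
Proof.
move=> us w cL ec ac; have cs := word_in_block w cL; case: w => pL aL sm.
have uL : uniq (flatten L) by rewrite (perm_uniq pL).
have dE d : d \in L -> deg d (m + U_(a))%MM = deg d (m + U_(e))%MM.
  move=> dL; have ud : uniq d.
    move: uL dL; elim: (L) => // b L' IH; rewrite /= cat_uniq inE.
    by case/and3P=> ub _ uL' /predU1P[->|] //; apply: IH.
  rewrite !degD !deg1 //; congr (_ + _)%N; congr (nat_of_bool _).
  apply/idP/idP => [ad|ed].
    by rewrite -(uniq_flatten_block uL cL dL ac ad).
  by rewrite -(uniq_flatten_block uL cL dL ec ed).
split; last first.
  rewrite /weight big_seq [RHS]big_seq; apply: eq_bigr => d dL.
  by rewrite dE.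
split=> //.
  rewrite -(eq_in_all (a1 := admissible (m + U_(e))%MM)) // => d dL.
  by rewrite /admissible dE.
apply: supportedU; first exact: cs.
by apply: supported_le sm => i; rewrite mnmDE leq_addr.
Qed.

(** The largest variable [e] of a block [c] is the sum of [c] and all blocks
    before it, minus the sum of the blocks before it, minus the rest of [c].
    The first sum cancels the denominator that separates [c] from the next
    block, the second one the denominator that separates it from the previous
    block (and vanishes if [c] is the first block), and the last one replaces
    [e] by smaller variables.  So either the number of blocks or the total
    exponent of largest variables decreases. *)
Lemma words_reduced s m b L :
  uniq s -> is_word s m (b :: L) ->
  in_span (reduced_words s (weight m (b :: L))) (word_value m (b :: L)).
Proof.
move=> us; have [N] := ubnP (size L); elim: N m b L => // N IHN m b L.
rewrite ltnS => LN.
have [t] := ubnP (\sum_(c <- L) topdeg m c)%N; elim: t m => // t IHt m.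
rewrite ltnS => mt w.
have IHN' m1 L1 : is_word s m1 L1 -> (0 < size L1)%N -> (size L1 <= size L)%N ->
    in_span (reduced_words s (weight m1 L1)) (word_value m1 L1).
  by case: L1 => // b1 L1 w1 _ lt; apply: IHN => //; apply: leq_trans LN.
have [red|/allPn[c cL /topdeg_neq0[e [ec te me]]]] := boolP (reduced m L).
  by apply: mem_span; exists m, b, L.
have mE := mnm_subU me; set m' := (m - U_(e))%MM in mE; rewrite mE in w mt *.
have [uL uc] : uniq (flatten (b :: L)) /\ uniq c.
  have [pL _ _] := w; have uL : uniq (flatten (b :: L)) by rewrite (perm_uniq pL).
  split=> //; move: uL; case/splitPr: cL {mt LN IHN' pL w IHt} => L1 L2.
  rewrite -cat_cons flatten_cat cat_uniq /= => /and3P[_ _].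
  by rewrite cat_uniq => /and3P[].
have rest : frac_sum c = mono U_(e) + frac_sum (rem e c).
  by rewrite /frac_sum (perm_wsum _ (perm_to_rem ec)) wsum_cons.
have cbL : c \in b :: L by rewrite inE cL orbT.
have T3 : in_span (reduced_words s (weight (m' + U_(e))%MM (b :: L)))
                  (mono m' * frac_sum (rem e c) * chain_inv L).
  rewrite mono_frac_sum mulr_suml; apply: span_sum => a ar _.
  have ac := mem_rem ar; have ae : a != e.
    by apply: contraTneq ar => ->; rewrite mem_rem_uniqF.
  have [wa <-] := word_swap us w cbL ec ac.
  apply: IHt => //; apply: leq_trans mt; apply: topdeg_swap te => //.
  by move: uL; rewrite /= cat_uniq => /and3P[].
case/splitPr: cL w mt LN IHN' uL cbL T3 {IHt} => L1 L2 w mt LN IHN' uL cbL T3.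
have c0 : frac_sum (flatten (c :: L2)) != 0.
  by apply: word_block_sum_neq0 us _; rewrite -cat_cons in w; exact: w.
have bE : b :: L1 ++ c :: L2 = belast b L1 ++ [:: last b L1, c & L2].
  by rewrite -cat_cons lastI cat_rcons.
have -> : word_value (m' + U_(e))%MM (b :: L1 ++ c :: L2) =
  mono m' * (chain_inv (L1 ++ c :: L2) * frac_sum (flatten (c :: L2))) -
  mono m' * (chain_inv (L1 ++ c :: L2) * frac_sum (flatten L2)) -
  mono m' * frac_sum (rem e c) * chain_inv (L1 ++ c :: L2).
  rewrite /word_value [behead _]/= monoD [flatten (c :: L2)]/= /frac_sum wsum_cat.
  by rewrite -!/(frac_sum _) rest; ring.
apply: spanB T3; apply: spanB.
  have elc : e \in last b L1 ++ c by rewrite mem_cat ec orbT.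
  have chE := chain_inv_fuse (belast b L1) (last b L1) c0.
  rewrite -bE [behead (b :: _)]/= in chE; rewrite [_ * frac_sum _]chE.
  rewrite bE in w *; have [wF <-] := fuse_down us w elc.
  apply: (IHN' _ _ wF); rewrite !size_cat /= ?size_belast ?addnS //.
case: L2 w c0 bE {mt LN cbL uL} IHN' => [|c2 L3] w c0 bE IHN'.
  by rewrite /frac_sum wsum_nil !mulr0; apply: span0.
have c20 : frac_sum (flatten (c2 :: L3)) != 0.
  have w' : is_word s (m' + U_(e))%MM (((b :: L1) ++ [:: c]) ++ c2 :: L3).
    by rewrite -catA.
  exact: word_block_sum_neq0 us w'.
have chE := chain_inv_fuse (b :: L1) c c20.
rewrite [_ * frac_sum _]chE.
have ecc : e \in c ++ c2 by rewrite mem_cat ec.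
have [wF <-] := fuse_down (L0 := b :: L1) us w ecc.
by apply: (IHN' _ _ wF); rewrite //= !size_cat /= !addnS.
Qed.

Lemma coef_reduced (T : tree n) :
  uniq (leaves T) -> in_span (reduced_words (leaves T) (nprec T)) (coef K T).
Proof.
move=> uT; apply: span_trans (coef_words K uT) => _ [m [b [L [w <- ->]]]].
exact: words_reduced.
Qed.

End ReducedWords.

(** * Residues *)
Section Residues.
Import GRing.Theory.
Local Open Scope ring_scope.

(** The morphism [sigma] is the restriction to the hypersurface [q = 0], and the
    fractions have at most a simple pole there.  Clearing all denominators
    multiplies the terms without pole by [q], which [sigma] kills. *)
Lemma residue_sum_eq0 (R R' : idomainType) (sigma : {rmorphism R -> R'})
    (I : finType) (A : {set I}) (b : pred I) (p g : I -> R) (q : R) :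
  q != 0 -> sigma q = 0 -> (forall i, i \in A -> sigma (g i) != 0) ->
  \sum_(i in A) tofrac (p i) / tofrac (if b i then q * g i else g i) = 0 ->
  \sum_(i in A | b i) tofrac (sigma (p i)) / tofrac (sigma (g i)) = 0.
Proof.
move=> q0 sq sg sum0.
have g0 i : i \in A -> g i != 0.
  by move=> iA; apply: contraNneq (sg i iA) => ->; rewrite rmorph0.
pose G i := \prod_(j in A | j != i) g j.
have gG i : i \in A -> \prod_(j in A) g j = g i * G i.
  by move=> iA; rewrite (bigD1 i).
have cleared : \sum_(i in A) p i * (if b i then 1 else q) * G i = 0.
  apply/eqP; rewrite -tofrac_eq0 rmorph_sum /=; apply/eqP.
  apply: etrans (etrans (congr1 _ sum0) (mulr0 (tofrac (q * \prod_(j in A) g j)))).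
  rewrite mulr_sumr.
  apply: eq_bigr => i iA; rewrite (gG i iA).
  have tg : tofrac (g i) != 0 by rewrite tofrac_eq0 g0.
  have tq : tofrac q != 0 by rewrite tofrac_eq0.
  have clear (F : fieldType) (y Q h H : F) : Q != 0 -> h != 0 ->
      y * H = Q * (h * H) * (y / (Q * h)) /\ y * Q * H = Q * (h * H) * (y / h).
    by move=> Q0 h0; split; field; rewrite ?Q0 ?h0.
  have [c1 c2] := clear _ (tofrac (p i)) _ _ (tofrac (G i)) tq tg.
  case: (b i); first by rewrite mulr1 !tofracM c1.
  by rewrite !tofracM c2.
have := congr1 sigma cleared; rewrite rmorph0 rmorph_sum => image0.
have sG : sigma (\prod_(j in A) g j) != 0.
  by rewrite rmorph_prod /=; apply/prodf_neq0.
apply: (@mulfI _ (tofrac (sigma (\prod_(j in A) g j)))).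
  by rewrite tofrac_eq0.
rewrite mulr0; apply: etrans (etrans (congr1 _ image0) (@tofrac0 R')).
rewrite mulr_sumr rmorph_sum /= [RHS](bigID b) /= [X in _ = _ + X]big1 ?addr0 => [|i /andP[_ /negbTE ->]].
  apply: eq_bigr => i /andP[iA bi].
  rewrite bi mulr1 (gG i iA) !(rmorphM sigma) !tofracM.
  have tsg : tofrac (sigma (g i)) != 0 by rewrite tofrac_eq0 sg.
  have clear (F : fieldType) (y h H : F) : h != 0 -> h * H * (y / h) = y * H.
    by move=> h0; field.
  exact: clear.
by rewrite !(rmorphM sigma) sq mulr0 mul0r tofrac0.
Qed.

End Residues.

(** * Linear independence *)
Section Independence.
Import GRing.Theory.
Local Open Scope ring_scope.
Variables (K : fieldType) (n : nat).
Implicit Types (s c l J : seq 'I_n) (L : seq (seq 'I_n)) (cs : seq {set 'I_n}).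
Implicit Types (m : 'X_{1..n}) (a e : 'I_n).

Local Notation mono := (@mono K n).
Local Notation chain_inv := (chain_inv (fun i => mono U_(i))).

Definition var_sum s : {mpoly K[n]} := \sum_(i <- s) 'X_i.

Lemma var_sum_cons a s : var_sum (a :: s) = 'X_a + var_sum s.
Proof. exact: big_cons. Qed.

Lemma var_sum_cat s l : var_sum (s ++ l) = var_sum s + var_sum l.
Proof. exact: big_cat. Qed.

Lemma var_sum_rem e s : e \in s -> var_sum s = 'X_e + var_sum (rem e s).
Proof. by move=> es; rewrite -var_sum_cons; apply: perm_big; apply: perm_to_rem. Qed.

Lemma var_sum_neq0 s : uniq s -> s != [::] -> var_sum s != 0.
Proof. by move=> us s0; rewrite -(@tofrac_eq0 {mpoly K[n]}) -frac_sumE frac_sum_neq0. Qed.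

(** Restriction to the hyperplane [var_sum J = 0], on which the variables other
    than [e] are coordinates if [e] belongs to [J]. *)
Definition elim_var e J : {mpoly K[n]} -> {mpoly K[n]} :=
  comp_mpoly [tuple (if i == e then - var_sum (rem e J) else 'X_i) | i < n].

Lemma elim_varX e J a :
  elim_var e J 'X_a = if a == e then - var_sum (rem e J) else 'X_a.
Proof. by rewrite /elim_var comp_mpolyXU -tnth_nth tnth_mktuple. Qed.

Lemma elim_var_mono e J m : m e = 0%N -> elim_var e J 'X_[m] = 'X_[m].
Proof.
move=> me; rewrite /elim_var comp_mpolyX [RHS]mpolyXE_id; apply: eq_bigr => i _.
by rewrite tnth_mktuple; case: eqP => // ->; rewrite me !expr0.
Qed.

Lemma elim_var_out e J s : e \notin s -> elim_var e J (var_sum s) = var_sum s.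
Proof.
move=> es; rewrite /elim_var /var_sum raddf_sum big_seq [RHS]big_seq.
apply: eq_bigr => i is_; rewrite [LHS]elim_varX; case: eqP => // ie.
by rewrite -ie is_ in es.
Qed.

Lemma elim_var_in e J s :
  uniq s -> e \in s -> elim_var e J (var_sum s) = var_sum (rem e s) - var_sum (rem e J).
Proof.
move=> us es; rewrite (var_sum_rem es) [LHS]raddfD /= -!/(elim_var _ _ _).
by rewrite elim_varX eqxx elim_var_out ?mem_rem_uniqF // addrC.
Qed.

Lemma elim_var_vanish e J : uniq J -> e \in J -> elim_var e J (var_sum J) = 0.
Proof. by move=> uJ eJ; rewrite elim_var_in // subrr. Qed.

Lemma elim_var_cat e J s :
  uniq (s ++ J) -> e \in J -> elim_var e J (var_sum (s ++ J)) = var_sum s.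
Proof.
rewrite cat_uniq => /and3P[_ /hasPn dis uJ] eJ.
rewrite var_sum_cat [LHS]raddfD /= -!/(elim_var _ _ _) elim_var_vanish // addr0.
by rewrite elim_var_out //; apply: dis.
Qed.

(** Some variable [a] belongs to exactly one of [s] and [J]; if [e] is in [s],
    this [a] is not [e] and keeps the coefficient 1 or -1 after [e] has been
    eliminated. *)
Lemma elim_var_neq0 e J s :
  uniq s -> s != [::] -> uniq J -> e \in J -> ~ s =i J ->
  elim_var e J (var_sum s) != 0.
Proof.
move=> us s0 uJ eJ sJ; have [es|es] := boolP (e \in s); last first.
  by rewrite elim_var_out // var_sum_neq0.
have [a aJ|no] := pickP (fun a => (a \in s) != (a \in J)); last first.
  by case: sJ => a; apply/eqP/negbFE/no.
have ae : a != e by apply: contraNneq aJ => ->; rewrite es eJ.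
rewrite elim_var_in //; apply/eqP => /(congr1 (mcoeff U_(a))).
rewrite mcoeffB mcoeff0 !mcoeff_sum_var ?rem_uniq // !mem_rem_uniq // !inE ae /=.
move/eqP; apply/negP; case: (a \in s) (a \in J) aJ => [] [] //= _.
  by rewrite subr0 oner_eq0.
by rewrite sub0r oppr_eq0 oner_eq0.
Qed.

(** Product of the denominators other than [var_sum J] in the chain that starts
    with the block [J] and continues with the blocks of [L]. *)
Fixpoint chain_den J L : {mpoly K[n]} :=
  if L is _ :: L' then var_sum (flatten L ++ J) * chain_den J L' else 1.

Lemma chain_invE L : chain_inv L = (tofrac (chain_den [::] L))^-1.
Proof.
elim: L => [|c L IH]; first by rewrite /= tofrac1 invr1.
by rewrite /= IH cats0 rmorphM invfM mulrC -/(frac_sum _ _) frac_sumE.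
Qed.

Lemma chain_den_rcons L J :
  chain_den [::] (rcons L J) = var_sum J * chain_den J L.
Proof.
elim: L => [|c L IH]; first by rewrite /= !cats0.
rewrite [LHS]/= IH [chain_den J _]/= !cats0 mulrCA; congr (_ * (_ * _)).
by rewrite flatten_rcons catA.
Qed.

Lemma chain_den_neq0 L :
  uniq (flatten L) -> [::] \notin L -> chain_den [::] L != 0.
Proof.
elim: L => [|c L IH] uL nL; first by rewrite oner_eq0.
rewrite [chain_den _ _]/= cats0 mulf_neq0 //.
  apply: var_sum_neq0 => //; move: nL; rewrite inE negb_or => /andP[c0 _].
  by case: (c) c0.
apply: IH; first by move: uL; rewrite /= cat_uniq => /and3P[].
by move: nL; rewrite inE negb_or => /andP[].
Qed.

Lemma elim_varM e J (p q : {mpoly K[n]}) :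
  elim_var e J (p * q) = elim_var e J p * elim_var e J q.
Proof. exact: rmorphM. Qed.

Lemma elim_var_chain_den e J L :
  uniq (flatten L ++ J) -> e \in J ->
  elim_var e J (chain_den J L) = chain_den [::] L.
Proof.
move=> uL eJ; elim: L uL => [|c L IH] uL; first exact: rmorph1.
rewrite [chain_den J _]/= [RHS]/= elim_varM cats0 elim_var_cat // IH //.
by move: uL; rewrite /= -catA cat_uniq => /and3P[].
Qed.

(** Every set of the chain contains [c], which has at least as many elements as
    [J] and differs from it; hence none of these sets is [J]. *)
Lemma elim_var_chain_neq0 e J L c :
  uniq (flatten (rcons L c)) -> c != [::] -> uniq J -> e \in J ->
  (size J <= size c)%N -> ~ c =i J ->
  elim_var e J (chain_den [::] (rcons L c)) != 0.
Proof.
move=> uL c0 uJ eJ Jc cJ; elim: L uL => [|d L IH] uL.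
  rewrite /= !cats0 mulr1 elim_var_neq0 //.
  by move: uL; rewrite /= cats0.
rewrite [chain_den _ _]/= elim_varM cats0 mulf_neq0 //; last first.
  by apply: IH; move: uL; rewrite /= cat_uniq => /and3P[].
apply: elim_var_neq0 => //.
  by rewrite flatten_rcons; case: (d) => //; case: (flatten L) => //; case: (c) c0.
move=> E; apply: cJ; have uc : uniq c.
  by move: uL; rewrite /= flatten_rcons catA cat_uniq => /and3P[].
have cJ : {subset c <= J}.
  by move=> i ic; rewrite -E /= flatten_rcons catA mem_cat ic orbT.
by have [] := uniq_min_size uc cJ Jc.
Qed.

(** The blocks of a word from the first on, without the last block, which does
    not enter the value.  Blocks are sets here, since permuting a list would
    give another word with the same value. *)
Definition chain := (seq {set 'I_n} * 'X_{1..n})%type.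

Definition chain_blocks (D : chain) := [seq enum b : seq 'I_n | b : {set 'I_n} <- D.1].

Definition chain_value (D : chain) : ratfun K n :=
  mono D.2 * chain_inv (rev (chain_blocks D)).

Definition reduced_chain (D : chain) :=
  [&& uniq (flatten (chain_blocks D)), [::] \notin chain_blocks D
    & reduced D.2 (chain_blocks D)].

Lemma exists_top c : c != [::] ->
  exists2 e, e \in c & all (fun j : 'I_n => j <= e)%N c.
Proof.
elim: c => // a [|b c] IH _; first by exists a; rewrite ?inE ?eqxx //= leqnn.
have [//|e ec te] := IH; have [ae|ea] := leqP a e.
  by exists e; rewrite ?[all _ _]/= ?ae // inE ec orbT.
exists a; rewrite ?inE ?eqxx //=; rewrite leqnn /=.
by apply: sub_all te => j /leq_trans; apply; apply: ltnW.
Qed.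

Lemma topdeg_eq0 m c e :
  topdeg m c = 0%N -> e \in c -> all (fun j : 'I_n => j <= e)%N c -> m e = 0%N.
Proof.
move=> t0 ec te; apply/eqP; rewrite -leqn0 -t0 /topdeg (big_rem e ec) te.
exact: leq_addr.
Qed.

Lemma mono_indep (I : finType) (A : {set I}) (m : I -> 'X_{1..n}) (c : I -> K) :
  {in A &, injective m} -> \sum_(i in A) c i *: mono (m i) = 0 ->
  forall i, i \in A -> c i = 0.
Proof.
move=> inj sum0 i iA.
have : \sum_(j in A) (c j)%:MP * 'X_[m j] = 0 :> {mpoly K[n]}.
  apply/eqP; rewrite -tofrac_eq0 rmorph_sum; apply/eqP; apply: etrans sum0.
  by apply: eq_bigr => j _; rewrite rmorphM.
move/(congr1 (mcoeff (m i))); rewrite (big_morph _ (mcoeffD _) (mcoeff0 _ _)).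
rewrite mcoeff0 (bigD1 i) //= mcoeffCM mcoeffX eqxx mulr1 big1 ?addr0 //.
move=> j /andP[jA ji]; rewrite mcoeffCM mcoeffX.
case: eqP => [E|_]; last by rewrite mulr0.
by rewrite (inj _ _ jA iA E) eqxx in ji.
Qed.

(** Let [J] be a first block of smallest size.  The chains that start with [J]
    are those with a pole along [var_sum J = 0], and this pole is simple.
    Restriction to the hyperplane deletes [J] from these chains, without
    changing their monomials, in which the eliminated variable does not occur,
    and kills all other terms.  So the coefficients of the chains starting
    with [J] vanish by induction, and then those of the others. *)
Lemma reduced_chain_indep (I : finType) (A : {set I}) (D : I -> chain) (c : I -> K) :
  {in A &, injective D} -> (forall i, i \in A -> reduced_chain (D i)) ->
  \sum_(i in A) c i *: chain_value (D i) = 0 -> forall i, i \in A -> c i = 0.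
Proof.
have [N] := ubnP (\sum_(i in A) (size (D i).1).+1)%N.
elim: N A D => // N IH A D; rewrite ltnS => szA injD redD sum0.
have [i0 /andP[i0A Di0]|no] := pickP (fun i => (i \in A) && ((D i).1 != [::])); last first.
  have D1 i : i \in A -> (D i).1 = [::].
    by move=> iA; apply/eqP; have := no i; rewrite iA => /negbFE.
  apply: (mono_indep (m := fun i => (D i).2)) => [i j iA jA E|].
    by apply: injD; rewrite // [D i]surjective_pairing [D j]surjective_pairing !D1 // E.
  apply: etrans sum0; apply: eq_bigr => i iA.
  by rewrite /chain_value /chain_blocks D1 // /= mulr1.
pose P i := (i \in A) && ((D i).1 != [::]).
have Pi0 : P i0 by rewrite /P i0A.
case: (@arg_minnP _ i0 P (fun i => #|head set0 (D i).1|) Pi0).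
move=> i1 /andP[i1A Di1] min; set J := head set0 (D i1).1 in min.
pose b i := ohead (D i).1 == Some J.
have bE i : b i -> (D i).1 = J :: behead (D i).1.
  by rewrite /b; case: (D i).1 => //= x t /eqP[->].
have bi1 : b i1 by rewrite /b /J; case: (D i1).1 Di1 => //=.
have blocks1 i : b i -> chain_blocks (D i) =
    (enum J : seq 'I_n) :: chain_blocks (behead (D i).1, (D i).2).
  by move=> bi; rewrite /chain_blocks (bE i bi).
have J0 : (enum J : seq 'I_n) != [::].
  have /and3P[_ + _] := redD i1 i1A.
  by rewrite blocks1 // inE negb_or eq_sym => /andP[].
have [e eJ te] := exists_top J0.
have uJ : uniq (enum J) := enum_uniq _.
pose L i := rev (chain_blocks (behead (D i).1, (D i).2)).
pose q := var_sum (enum J).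
pose g i := if b i then chain_den (enum J) (L i)
            else chain_den [::] (rev (chain_blocks (D i))).
have valE i : chain_value (D i) =
    tofrac 'X_[(D i).2] / tofrac (if b i then q * g i else g i).
  rewrite /chain_value chain_invE /g; have [bi|//] := boolP (b i).
  by rewrite blocks1 // rev_cons chain_den_rcons.
have uflat i : i \in A -> uniq (flatten (chain_blocks (D i))).
  by move=> iA; have /and3P[] := redD i iA.
have perm_rev L1 : perm_eq (flatten (rev L1)) (flatten L1) :> bool.
  by apply: perm_flatten; rewrite perm_rev.
have uflatJ i : i \in A -> b i -> uniq (flatten (L i) ++ enum J).
  move=> iA bi; have := uflat i iA; rewrite -(perm_uniq (perm_rev _)) blocks1 //.
  by rewrite rev_cons flatten_rcons.
have sg i : i \in A -> elim_var e (enum J) (g i) != 0.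
  move=> iA; rewrite /g; have /and3P[ui ni _] := redD i iA.
  case: ifP => [bi|/negbT bi].
    rewrite elim_var_chain_den ?uflatJ // chain_den_neq0 //.
      by have := uflatJ i iA bi; rewrite cat_uniq => /and3P[].
    by move: ni; rewrite blocks1 // inE negb_or mem_rev => /andP[].
  case E : (D i).1 => [|x t].
    by rewrite /chain_blocks E /= [elim_var _ _ _]rmorph1 oner_eq0.
  have Pi : P i by rewrite /P iA E.
  have := min i Pi; rewrite E /= => Jx.
  rewrite /chain_blocks E /= rev_cons elim_var_chain_neq0 //.
  - rewrite -rev_cons -(map_cons (fun b : {set 'I_n} => enum b)).
    by rewrite (perm_uniq (perm_rev _)); move: ui; rewrite /chain_blocks E.
  - by move: ni; rewrite /chain_blocks E /= inE negb_or eq_sym => /andP[].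
  - by rewrite -!cardE.
  - move=> xJ; case/negP: bi; rewrite /b E /=; apply/eqP; congr Some.
    by apply/setP => a; have := xJ a; rewrite !mem_enum.
have mJ i : i \in A -> b i -> (D i).2 e = 0%N.
  move=> iA bi; have /and3P[_ _] := redD i iA; rewrite blocks1 //.
  by case/andP=> /eqP t0 _; apply: topdeg_eq0 te.
have q0 : q != 0 by apply: var_sum_neq0.
have sq : elim_var e (enum J) q = 0 by apply: elim_var_vanish.
pose p i := (c i)%:MP * 'X_[(D i).2].
have sum0' : \sum_(i in A) tofrac (p i) / tofrac (if b i then q * g i else g i) = 0.
  apply: etrans sum0; apply: eq_bigr => i iA.
  by rewrite valE /p rmorphM -mulrA.
have res : \sum_(i in A | b i) tofrac (elim_var e (enum J) (p i)) /
                                 tofrac (elim_var e (enum J) (g i)) = 0.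
  exact: residue_sum_eq0 q0 sq sg sum0'.
pose A1 := [set i in A | b i].
have A1A i : i \in A1 -> i \in A /\ b i by rewrite inE => /andP[].
have i1A1 : i1 \in A1 by rewrite inE i1A.
have c1 : forall i, i \in A1 -> c i = 0.
  apply: (IH A1 (fun i => (behead (D i).1, (D i).2))).
  - apply: leq_trans szA; rewrite (bigD1 i1) //= [X in (_ < X)%N](bigD1 i1) //=.
    rewrite -addSn leq_add //.
      by rewrite (bE i1 bi1) /=.
    rewrite [X in (X <= _)%N]big_mkcond [X in (_ <= X)%N]big_mkcond /=.
    apply: leq_sum => j _; rewrite inE; case: (j \in A); case: (b j) => //=.
    by case: (j != i1); rewrite //= size_behead ltnS leq_pred.
  - move=> i j /A1A[iA bi] /A1A[jA bj] [E1 E2]; apply: injD => //.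
    by rewrite [D i]surjective_pairing [D j]surjective_pairing E2 (bE i bi) (bE j bj) E1.
  - move=> i /A1A[iA bi]; have /and3P[ui ni ri] := redD i iA.
    rewrite /reduced_chain; move: ui ni ri; rewrite blocks1 //= inE negb_or.
    by rewrite cat_uniq => /and3P[_ _ ->] /andP[_ ->] /andP[_ ->].
  - apply: etrans res; apply: eq_big => [i|i /A1A[iA bi]]; first by rewrite inE.
    rewrite /p /g bi.
    rewrite elim_var_chain_den ?uflatJ // elim_varM elim_var_mono ?mJ //.
    rewrite /elim_var comp_mpolyC rmorphM -mulrA.
    by rewrite /chain_value chain_invE.
have A1s : A1 \subset A by apply/subsetP => i /A1A[].
have c2 : forall i, i \in A :\: A1 -> c i = 0.
  apply: (IH _ D).
  - apply: leq_trans szA; rewrite [X in (_ < X)%N](big_setID A1) /=.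
    by rewrite (setIidPr A1s) -[X in (X < _)%N]add0n ltn_add2r (bigD1 i1).
  - by move=> i j /setDP[iA _] /setDP[jA _]; apply: injD.
  - by move=> i /setDP[iA _]; apply: redD.
  - apply: etrans sum0; rewrite [RHS](big_setID A1) /= [X in X + _]big1 ?add0r //.
    by move=> i /setIP[_ /c1 ->]; rewrite scale0r.
by move=> i iA; have [/c1|iA1] := boolP (i \in A1) => //; apply: c2; rewrite inE iA1.
Qed.

End Independence.

(** * The set B and reduced words *)
Section Translation.
Import GRing.Theory.
Local Open Scope ring_scope.
Variables (K : fieldType) (n : nat).
Implicit Types (b c : seq 'I_n) (L cs : seq (seq 'I_n)) (m : 'X_{1..n}).
Implicit Types (f : ratfun K n) (a i : 'I_n).

Local Notation mono := (@mono K n).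
Local Notation frac_sum := (@frac_sum K n).
Local Notation chain_inv := (chain_inv (fun i => mono U_(i))).
Local Notation in_B := (@in_B K n).

Lemma chain_inv_rev cs :
  chain_inv (rev cs) =
  (\prod_(1 <= t < (size cs).+1) frac_sum (flatten (take t cs)))^-1.
Proof.
elim/last_ind: cs => [|cs c IH]; first by rewrite big_geq // invr1.
rewrite rev_rcons size_rcons big_nat_recr //= IH invfM.
congr (_ / _).
  congr (_^-1); apply: eq_big_nat => t /andP[_ tc].
  by rewrite -cats1 takel_cat.
rewrite -(size_rcons cs c) take_size; apply: perm_wsum.
rewrite -[c ++ _]/(flatten (c :: rev cs)) -rev_rcons.
by apply: perm_flatten; rewrite perm_rev.
Qed.

Lemma psum_enum (A : {set 'I_n}) : psum K A = frac_sum (enum A).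
Proof.
by rewrite -psum_frac_sum ?enum_uniq //; congr psum; apply/setP => i; rewrite inE mem_enum.
Qed.

Lemma deg_enum (A : {set 'I_n}) m : deg (enum A) m = (\sum_(i in A) m i)%N.
Proof. by rewrite /deg big_enum. Qed.

Lemma weight_double m L :
  all (admissible m) L ->
  (\sum_(c <- L) (deg c m + size c) = (weight m L).*2 + size L)%N.
Proof.
elim: L => [|c L IH] /=; first by rewrite /weight !big_nil.
by case/andP=> /andP[_ od] /IH E; rewrite big_cons E weight_cons; lia.
Qed.

Lemma sum_size_word L :
  perm_eq (flatten L) (enum 'I_n) -> (\sum_(c <- L) size c = n)%N.
Proof.
move=> pL; apply: etrans (etrans (perm_size pL) (size_enum_ord n)).
by rewrite size_flatten sumnE /shape big_map.
Qed.

Lemma mono_sum (I : Type) (r : seq I) (P : pred I) (M : I -> 'X_{1..n}) :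
  mono (\sum_(t <- r | P t) M t)%MM = \prod_(t <- r | P t) mono (M t).
Proof. exact: (big_morph mono (@monoD K n) (mono0 K n)). Qed.

(** ** From chains of sets to words *)

(** The numerators are multiplied to a single monomial [m]; as their blocks are
    disjoint, [M s] is the part of [m] in the block [s]. *)
Lemma in_B_word k f : in_B k f ->
  exists (Bs : seq {set 'I_n}) (B : {set 'I_n}) m,
    let L := rev [seq enum A | A : {set 'I_n} <- Bs] in
    [/\ is_word (enum 'I_n) m ((enum B : seq 'I_n) :: L), reduced m L,
        weight m ((enum B : seq 'I_n) :: L) = k
      & f = word_value K m ((enum B : seq 'I_n) :: L)].
Proof.
move=> [j [I [d [M [[I0 IT prI] dP sumd [Mlow Mtop] ->]]]]].
have subI s t : (s <= t)%N -> (t <= j.+1)%N -> I s \subset I t.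
  move=> st; rewrite -(subnKC st); elim: (t - s)%N => [|r IH]; first by rewrite addn0.
  rewrite addnS => lt; apply: subset_trans (IH (ltnW lt)) _.
  by apply: proper_sub; apply: prI.
pose bl s : seq 'I_n := enum (block I s).
have disj s t i : (1 <= s)%N -> (s <= j.+1)%N -> (1 <= t)%N -> (t <= j.+1)%N ->
    i \in block I s -> i \in block I t -> s = t.
  move=> s1 sj t1 tj; rewrite !inE => /andP[is1 is_] /andP[it1 it_].
  case: (ltngtP s t) => // lt.
    by case/negP: it1; apply: (subsetP (subI s t.-1 _ _)) => //; lia.
  by case/negP: is1; apply: (subsetP (subI t s.-1 _ _)) => //; lia.
have Msupp s i : (1 <= s)%N -> (s <= j.+1)%N -> M s i != 0%N -> i \in block I s.
  move=> s1; rewrite leq_eqVlt => /predU1P[->|sj].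
    by case: Mtop => _; apply.
  by have [] := Mlow s; rewrite ?s1 // => _ sub /sub; rewrite inE => /andP[].
have Mdeg s : (1 <= s)%N -> (s <= j.+1)%N -> mdeg (M s) = d s.
  move=> s1; rewrite leq_eqVlt => /predU1P[->|sj]; first by case: Mtop.
  by have [] := Mlow s; rewrite ?s1.
pose m := (\sum_(1 <= s < j.+2) M s)%MM.
have mE s i : (1 <= s)%N -> (s <= j.+1)%N -> i \in block I s -> m i = M s i.
  move=> s1 sj is_; rewrite mnm_sumE (bigD1_seq s) ?iota_uniq //=; last first.
    by rewrite mem_index_iota s1.
  rewrite big1_seq ?addn0 // => t /andP[ts]; rewrite mem_index_iota => /andP[t1 tj].
  apply/eqP; apply: contraNT ts => Mti; apply/eqP.
  by apply: (disj t s i) => //; apply: Msupp.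
have degE s : (1 <= s)%N -> (s <= j.+1)%N -> deg (bl s) m = d s.
  move=> s1 sj; rewrite deg_enum -(Mdeg s s1 sj) mdegE.
  rewrite [RHS](bigID (mem (block I s))) /= [X in (_ + X)%N]big1 ?addn0.
    by apply: eq_bigr => i; apply: mE.
  by move=> i is_; apply/eqP; apply: contraNT is_; apply: Msupp.
have card0 s : (1 <= s)%N -> (s <= j.+1)%N -> (0 < #|block I s|)%N.
  case: s => // s _ sj; have /properP[_ [i iS iN]] := prI s sj.
  by rewrite card_gt0; apply/set0Pn; exists i; rewrite inE iN.
have adm s : (1 <= s)%N -> (s <= j.+1)%N -> admissible m (bl s).
  move=> s1 sj; have [|le /eqP eq2] := dP s; first by rewrite s1.
  have c0 := card0 s s1 sj.
  have sz : size (bl s) = #|block I s| := esym (cardE _).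
  rewrite /admissible degE // sz; move: eq2 le c0; rewrite !modn2 => /eqP.
  by move: #|block I s| => x /eqP eq2 le c0; apply/andP; split; lia.
pose cs t := [seq bl s | s <- iota 1 t].
have csS t : cs t.+1 = rcons (cs t) (bl t.+1).
  by rewrite /cs -(addn1 t) iotaD map_cat cats1 addnC.
have flatE t : (t <= j.+1)%N -> perm_eq (flatten (cs t)) (enum (I t)).
  elim: t => [|t IH] tj; first by rewrite I0 enum_set0.
  rewrite csS flatten_rcons.
  apply: (@perm_trans _ (enum (I t) ++ bl t.+1)).
    by rewrite perm_cat2r; apply: IH; apply: ltnW.
  apply: uniq_perm; rewrite ?enum_uniq //.
    rewrite cat_uniq !enum_uniq andbT; apply/hasPn => i.
    by rewrite !mem_enum inE => /andP[].
  move=> i; rewrite mem_cat !mem_enum inE /=.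
  have := subsetP (proper_sub (prI t tj)) i.
  by case: (i \in I t) => // ->.
have all_cs (P : pred (seq 'I_n)) t :
    (forall s, (1 <= s)%N -> (s <= t)%N -> P (bl s)) -> all P (cs t).
  move=> Pb; rewrite all_map; apply/allP => s; rewrite mem_iota add1n => /andP[s1 st].
  exact: Pb.
exists [seq block I s | s <- iota 1 j], (block I j.+1), m => L.
have LE : (enum (block I j.+1) : seq 'I_n) :: L = rev (cs j.+1).
  by rewrite csS rev_rcons /L -map_comp.
have admL : all (admissible m) (rev (cs j.+1)).
  by rewrite all_rev; apply: all_cs => s; apply: adm.
have pL : perm_eq (flatten (rev (cs j.+1))) (enum 'I_n).
  apply: (@perm_trans _ (flatten (cs j.+1))).
    by apply: perm_flatten; rewrite perm_rev.
  apply: perm_trans (flatE _ _) _ => //; rewrite IT.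
  by apply: uniq_perm; rewrite ?enum_uniq // => i; rewrite !mem_enum inE.
rewrite LE; split.
- by split=> // a _; rewrite mem_enum.
- rewrite /L /reduced all_rev -map_comp; apply: (all_cs _ j) => s s1 sj.
  rewrite /topdeg big1_seq // => i /andP[ti]; rewrite mem_enum => is_.
  rewrite (mE s) //; last exact: leqW.
  apply/eqP; apply: contraTT is_ => Msi.
  have [_ /(_ i Msi)] := Mlow s (introT andP (conj s1 sj)).
  rewrite inE => /andP[is_]; case/negP; rewrite eqn_leq.
  rewrite (bigmax_sup i) //=; apply/bigmax_leqP => a ab.
  by apply: (allP ti); rewrite mem_enum.
- have := weight_double admL; rewrite size_rev size_map size_iota.
  rewrite (perm_big (cs j.+1)) ?perm_rev //= big_split /=.
  have -> : (\sum_(c <- cs j.+1) size c = n)%N.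
    by rewrite -[RHS](sum_size_word pL) [RHS](perm_big (cs j.+1)) ?perm_rev.
  have -> : (\sum_(c <- cs j.+1) deg c m = \sum_(1 <= s < j.+2) d s)%N.
    rewrite big_map -[iota _ _]/(index_iota 1 j.+2); apply: eq_big_nat => s /andP[s1 sj].
    exact: degE.
  rewrite sumd; lia.
- rewrite /word_value csS rev_rcons [behead _]/= chain_inv_rev mono_sum.
  congr (_ / _); rewrite size_map size_iota; apply: eq_big_nat => s /andP[s1 sj].
  rewrite psum_enum; apply: esym; apply: perm_wsum.
  by rewrite -map_take take_iota (minn_idPl _) //; apply: flatE; apply: leqW.
Qed.

(** ** From words to chains of sets *)

Lemma restrict_flatten L m :
  uniq (flatten L) -> restrict (flatten L) m = (\sum_(c <- L) restrict c m)%MM.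
Proof.
elim: L => [|c L IH] uL.
  by rewrite big_nil; apply/mnmP => i; rewrite !mnmE.
have [_ dis uL'] := and3P (etrans (esym (cat_uniq _ _)) uL).
rewrite big_cons -IH //; apply/mnmP => i; rewrite mnmDE !mnmE /= mem_cat.
have [iL|iL] := boolP (i \in flatten L); last by rewrite orbF addn0.
by rewrite orbT (negbTE (hasPn dis i iL)).
Qed.

Lemma word_in_B k f : reduced_words (enum 'I_n) k f -> in_B k f.
Proof.
move=> [m [b [L [[pL aL _] red <- ->]]]].
set cs := rev (b :: L); pose blk s := nth [::] cs s.-1.
have pcs : perm_eq (flatten cs) (enum 'I_n).
  apply: perm_trans pL; apply: perm_flatten; by rewrite perm_rev.
have ucs : uniq (flatten cs) by rewrite (perm_uniq pcs) enum_uniq.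
have szcs : size cs = (size L).+1 by rewrite size_rev.
pose I s := [set i in flatten (take s cs)].
have utake s : uniq (flatten (take s cs)).
  by move: ucs; rewrite -{1}(cat_take_drop s cs) flatten_cat cat_uniq => /and3P[].
have takeS s : (s <= size L)%N -> take s.+1 cs = rcons (take s cs) (blk s.+1).
  by move=> sL; rewrite (take_nth [::]) // szcs.
have blockE s : (1 <= s <= (size L).+1)%N -> block I s = [set i in blk s].
  case: s => // s /= sL; apply/setP => i; rewrite /block !inE takeS //.
  have := utake s.+1; rewrite takeS // flatten_rcons cat_uniq mem_cat.
  case/and3P=> _ /hasPn dis _; have [ib|] := boolP (i \in blk s.+1).
    by rewrite orbT andbT; apply: dis.
  by rewrite orbF andNb.
have ublk s : (1 <= s <= (size L).+1)%N -> uniq (blk s).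
  case: s => // s /= sL; have := utake s.+1.
  by rewrite takeS // flatten_rcons cat_uniq => /and3P[].
have cblk s : (1 <= s <= (size L).+1)%N -> #|block I s| = size (blk s).
  by move=> sL; rewrite blockE // cardsE; apply/card_uniqP/ublk.
have blk_in s : (1 <= s <= (size L).+1)%N -> blk s \in cs.
  by case: s => // s /= sL; apply: mem_nth; rewrite szcs.
have adm s : (1 <= s <= (size L).+1)%N -> admissible m (blk s).
  by move=> sL; apply: (allP aL); rewrite -mem_rev; apply: blk_in.
have sumblk (F : seq 'I_n -> nat) :
    (\sum_(1 <= s < (size L).+2) F (blk s) = \sum_(c <- b :: L) F c)%N.
  rewrite big_add1 -szcs -(big_nth [::] xpredT F).
  by apply: perm_big; rewrite perm_rev.
have mdeg_blk s : (1 <= s <= (size L).+1)%N -> mdeg (restrict (blk s) m) = deg (blk s) m.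
  move=> sL; rewrite -(deg_mdeg (ublk s sL) (@supported_restrict n _ m)).
  by apply: eq_deg => i; rewrite mnmE => ->.
exists (size L), I, (fun s => deg (blk s) m), (fun s => restrict (blk s) m).
split.
- split=> [||s sL]; first by apply/setP => i; rewrite !inE take0.
    apply/setP => i; rewrite !inE -szcs take_size (perm_mem pcs) mem_enum.
    by rewrite inE.
  have blkI i : i \in I s.+1 = (i \in I s) || (i \in blk s.+1).
    by rewrite !inE takeS // flatten_rcons mem_cat.
  apply/properP; split; first by apply/subsetP => i; rewrite blkI => ->.
  have := cblk s.+1 sL; have /andP[lt _] := adm s.+1 sL.
  move=> cE; have : (0 < #|block I s.+1|)%N by rewrite cE; lia.
  by case/card_gt0P=> i; rewrite inE => /andP[iN iS]; exists i.
- move=> s sL; rewrite cblk //; have /andP[lt od] := adm s sL.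
  split; first lia.
  by rewrite !modn2; congr nat_of_bool; lia.
- rewrite (sumblk (fun c => deg c m)).
  have := weight_double aL; rewrite big_split /= sum_size_word //; lia.
- split=> [s /andP[s1 sL]|].
    have sL' : (1 <= s <= (size L).+1)%N by rewrite s1 leqW.
    split; first exact: mdeg_blk.
    move=> a Ma; have ab := supported_restrict Ma.
    rewrite /delmax in_set blockE // in_set ab /=.
    apply: contraNneq Ma => amax; rewrite mnmE ab; apply/eqP.
    have red_s : topdeg m (blk s) = 0%N.
      apply/eqP; apply: (allP red); rewrite -mem_rev /blk /cs rev_cons nth_rcons size_rev.
      by case: (s) s1 sL => // s' _ /= sL; rewrite sL mem_nth // size_rev.
    apply: topdeg_eq0 red_s ab _; apply/allP => j jb; rewrite amax.
    by rewrite /setmax (bigmax_sup j) // inE.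
  split=> [|a Ma]; first by apply: mdeg_blk; rewrite leqnn.
  by rewrite blockE ?leqnn // inE; apply: supported_restrict Ma.
- rewrite /word_value [behead _]/= -[L in chain_inv L]revK chain_inv_rev size_rev.
  congr (_ / _).
    rewrite -/(mono _) -mono_sum; congr mono.
    rewrite big_add1 -szcs -(big_nth [::] xpredT (fun c => restrict c m)).
    rewrite -restrict_flatten //; apply/mnmP => i.
    by rewrite mnmE (perm_mem pcs) mem_enum.
  apply: eq_big_nat => s /andP[s1 sL]; rewrite psum_frac_sum //; congr (frac_sum (flatten _)).
  by rewrite /cs rev_cons -cats1 takel_cat // size_rev.
Qed.

End Translation.

(** * The bases *)
Section Bases.
Import GRing.Theory.
Local Open Scope ring_scope.
Variables (K : fieldType) (n : nat).
Implicit Types (f : ratfun K n) (T : tree n).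

Lemma in_B_tree_span k f : in_B k f -> tree_span (enum 'I_n) k f.
Proof.
move=> /in_B_word [Bs [B [m [w _ <- ->]]]].
by apply: word_tree_span w; rewrite ?enum_uniq.
Qed.

Lemma in_B_chain k f : in_B k f ->
  exists D : chain n, reduced_chain D /\ f = chain_value K D.
Proof.
move=> /in_B_word [Bs [B [m [[pL aL _] red _ ->]]]].
exists (Bs, m); split=> //; rewrite /reduced_chain; apply/and3P; split.
- rewrite -(perm_uniq (s1 := flatten (rev (chain_blocks (Bs, m))))); last first.
    by apply: perm_flatten; rewrite perm_rev.
  have : uniq (flatten ((enum B : seq 'I_n) :: rev (chain_blocks (Bs, m)))).
    by rewrite (perm_uniq pL) enum_uniq.
  by rewrite /= cat_uniq => /and3P[].
- have := admissible_nonempty aL.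
  by rewrite inE negb_or mem_rev => /andP[].
- by move: red; rewrite /reduced all_rev.
Qed.

(** Chains do not record the weight, so this applies to each of the sets
    [in_B k] and to their union alike. *)
Lemma chain_lin_indep (S : ratfun K n -> Prop) :
  (forall f, S f -> exists D : chain n, reduced_chain D /\ f = chain_value K D) ->
  lin_indep S.
Proof.
move=> SD p c x inj Sx sum0 i.
have [D DP] := fin_all_exists (fun i => SD _ (Sx i)).
apply: (@reduced_chain_indep K n _ [set: 'I_p] D c) => //.
- move=> i1 i2 _ _ E; apply: inj.
  by rewrite (proj2 (DP i1)) (proj2 (DP i2)) E.
- by move=> j _; case: (DP j).
- apply: etrans sum0; apply: eq_big => [j|j _]; first by rewrite inE.
  by rewrite (proj2 (DP j)).
Qed.

Lemma multilinearP T : multilinear T <-> perm_eq (leaves T) (enum 'I_n).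
Proof.
split=> [mT|pT i].
  have inT i : i \in leaves T by rewrite -has_pred1 has_count mT.
  apply: uniq_perm (enum_uniq _) _ => [|i]; last by rewrite mem_enum inT.
  by apply: count_mem_uniq => i; rewrite mT inT.
by rewrite (permP pT) count_uniq_mem ?enum_uniq // mem_enum.
Qed.

Lemma coef_in_B T : multilinear T -> in_span (in_B (nprec T)) (coef K T).
Proof.
move=> /multilinearP pT.
have uT : uniq (leaves T) by rewrite (perm_uniq pT) enum_uniq.
apply: span_trans (coef_reduced K uT) => _ [m [b [L [[pL aL sm] red kE ->]]]].
apply/mem_span/word_in_B; exists m, b, L; split=> //; split=> //.
  exact: perm_trans pL pT.
exact: supported_perm sm.
Qed.

Lemma nprec_lt_size T : (nprec T < size (leaves T))%N.
Proof. by elim: T => //= U IHU V IHV; rewrite size_cat; lia. Qed.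

Lemma nprec_multilinear T : multilinear T -> (nprec T <= n - 1)%N.
Proof.
move=> /multilinearP /perm_size; rewrite size_enum_ord => sT.
have := nprec_lt_size T; rewrite sT; lia.
Qed.

End Bases.

Theorem theorem1 (K : fieldType) (charK0 : [pchar K]%R =i pred0)
    (n : nat) (n_ge1 : 1 <= n) :
  (forall k : nat, k <= n - 1 -> is_basis (@in_B K n k) (@Rspace_k K n k)) /\
  is_basis (fun f : ratfun K n => exists2 k : nat, k <= n - 1 & in_B k f)
           (@Rspace K n).
Proof.
split=> [k _|]; split.
- by apply: chain_lin_indep => f; apply: in_B_chain.
- move=> v; split; apply: span_trans => {}v.
    by move=> [T [mT <- ->]]; apply: coef_in_B.
  move=> /in_B_tree_span; apply: span_trans => _ [T [/multilinearP mT <- ->]].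
  by apply: mem_span; exists T.
- by apply: chain_lin_indep => f [k _]; apply: in_B_chain.
- move=> v; split; apply: span_trans => {}v.
    move=> [T mT ->]; apply: span_trans (coef_in_B K mT) => f fB.
    by apply: mem_span; exists (nprec T) => //; apply: nprec_multilinear.
  move=> [k _ /in_B_tree_span]; apply: span_trans => _ [T [/multilinearP mT _ ->]].
  by apply: mem_span; exists T.
Qed.
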